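(* For every class $\mathcal{C}\in\{\mathsf{DFA},\mathsf{NFA},\mathsf{DPDA},\mathsf{PDA}\}$, the problem $\mathsf{TED}(\mathcal{C},\mathsf{DPDA})$ is undecidable.
   Context: A pushdown automaton (PDA) is a tuple $(\Sigma,\Gamma,Q,S,\delta,F)$ with input alphabet $\Sigma$, finite stack alphabet $\Gamma$, finite state set $Q$, initial states $S\subseteq Q$, a finite transition relation $\delta\subseteq Q\times\Sigma\times(\Gamma\cup\{\bot\})\times Q\times\Gamma^*$ and final states $F\subseteq Q$. A run on $w=w[1]\dots w[k]$ is a sequence $\pi[0],\dots,\pi[k]$ in $Q\times\Gamma^*$ with $\pi[0]\in S\times\{\epsilon\}$ such that for each $i\in\{1,\dots,k\}$ either $\pi[i-1]=(q,\epsilon)$, $\pi[i]=(q',u')$ and $(q,w[i],\bot,q',u')\in\delta$, or $\pi[i-1]=(q,ua)$ with $a\in\Gamma$, $\pi[i]=(q',uu')$ and $(q,w[i],a,q',u')\in\delta$. It is accepting if $\pi[k]\in F\times\{\epsilon\}$. $\mathcal{L}(\mathcal{A})$ is the set of words having an accepting run. A PDA is deterministic (DPDA) if $|S|=1$ and $\delta$ is a (possibly partial) function from $Q\times\Sigma\times(\Gamma\cup\{\bot\})$ to $Q\times\Gamma^*$. An NFA is a PDA with empty stack alphabet (an ordinary nondeterministic finite automaton); a DFA is a deterministic NFA. $\mathsf{PDA},\mathsf{DPDA},\mathsf{NFA},\mathsf{DFA}$ denote the classes of these automata. The edit distance $ed(w_1,w_2)$ of two words is the minimal number of single-letter insertions,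 deletions and substitutions transforming $w_1$ into $w_2$. For languages, $ed(\mathcal{L}_1,\mathcal{L}_2)=\sup_{w_1\in\mathcal{L}_1}\inf_{w_2\in\mathcal{L}_2}ed(w_1,w_2)$. The problem $\mathsf{TED}(\mathcal{C}_1,\mathcal{C}_2)$: given $\mathcal{A}_1\in\mathcal{C}_1$, $\mathcal{A}_2\in\mathcal{C}_2$ and an integer $k\ge 0$, decide whether $ed(\mathcal{L}(\mathcal{A}_1),\mathcal{L}(\mathcal{A}_2))\le k$. *)

(* Defs.v *)
From mathcomp Require Import all_boot all_order all_algebra.
From mathcomp Require Import boolp classical_sets reals ereal.
Set Implicit Arguments.
Unset Strict Implicit.
Unset Printing Implicit Defensive.

Local Open Scope classical_set_scope.

(** * Pushdown automata *)

(* In a transition [(q, s, a, q', u)], [a = None] is the empty-stack marker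
   (bottom) and [a = Some b] requires [b] on top of the stack.  The finite
   transition relation is given by a listing of its elements. *)
Record pda (Sigma : finType) : Type := Pda {
  stack_sym : finType;
  state : finType;
  initial : {set state};
  trans : seq (state * Sigma * option stack_sym * state * seq stack_sym);
  final : {set state}
}.

Section Runs.
Variables (Sigma : finType) (A : pda Sigma).

(* The top of the stack is the right end of the sequence. *)
Definition config : Type := (state A * seq (stack_sym A))%type.

Definition step (s : Sigma) (c c' : config) : Prop :=
  (exists q q' u',
     [/\ c = (q, [::]), c' = (q', u') & (q, s, None, q', u') \in trans A])
  \/
  (exists q u a q' u',
     [/\ c = (q, rcons u a), c' = (q', u ++ u')
       & (q, s, Some a, q', u') \in trans A]).

(* Only the values [pi 0, ..., pi (size w)] are relevant. *)
Definition is_run (w : seq Sigma) (pi : nat -> config) : Prop :=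
  [/\ (pi 0).1 \in initial A, (pi 0).2 = [::]
    & forall i s, onth w i = Some s -> step s (pi i) (pi i.+1)].

Definition is_accepting_run (w : seq Sigma) (pi : nat -> config) : Prop :=
  [/\ is_run w pi, (pi (size w)).1 \in final A & (pi (size w)).2 = [::]].

Definition language : set (seq Sigma) :=
  [set w | exists pi, is_accepting_run w pi].

Definition deterministic : Prop :=
  #|initial A| = 1 /\
  forall q s a q1 u1 q2 u2,
    (q, s, a, q1, u1) \in trans A -> (q, s, a, q2, u2) \in trans A ->
    (q1, u1) = (q2, u2).

Definition empty_stack_alphabet : Prop := #|stack_sym A| = 0.

End Runs.

Inductive automata_class : Type := DFA | NFA | DPDA | PDA.

Definition in_class (C : automata_class) (Sigma : finType) (A : pda Sigma) :
    Prop :=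
  match C with
  | DFA => empty_stack_alphabet A /\ deterministic A
  | NFA => empty_stack_alphabet A
  | DPDA => deterministic A
  | PDA => True
  end.

(** * Edit distance *)

Section EditDistance.
Variable Sigma : finType.
Implicit Types w : seq Sigma.

Inductive edit : seq Sigma -> seq Sigma -> Prop :=
| edit_ins u v a : edit (u ++ v) (u ++ a :: v)
| edit_del u v a : edit (u ++ a :: v) (u ++ v)
| edit_sub u v a b : edit (u ++ a :: v) (u ++ b :: v).

Fixpoint edits (n : nat) w1 w2 : Prop :=
  if n is m.+1 then exists2 w, edit w1 w & edits m w w2 else w1 = w2.

Lemma edits_exists w1 w2 : exists n, `[< edits n w1 w2 >].
Proof.
exists (size w1 + size w2)%N; apply/asboolP.
elim: w1 => [|a w1 IH] /=; last by exists w1 => //; exact: (edit_del [::]).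
rewrite add0n -{2}[w2]cats0; move: [::] => v.
elim/last_ind: w2 v => [|w2 b IH] v //=.
rewrite size_rcons; exists (b :: v); first exact: (edit_ins [::]).
by rewrite -cats1 -catA.
Qed.

Definition ed w1 w2 : nat := ex_minn (edits_exists w1 w2).

(* [ereal_inf set0 = +oo]; [ereal_sup set0 = -oo] plays the role of the
   least value of the distance, and is below every threshold [k >= 0]. *)
Definition lang_ed (R : realType) (L1 L2 : set (seq Sigma)) : \bar R :=
  ereal_sup [set ereal_inf [set (((ed w1 w2)%:R : R)%R)%:E | w2 in L2]
            | w1 in L1].

End EditDistance.

(** * Partial recursive functions *)

Inductive recfun : nat -> Type :=
| RZero n : recfun n
| RSucc : recfun 1
| RProj n (i : 'I_n) : recfun n
| RComp m n (f : recfun m) (g : 'I_m -> recfun n) : recfun n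
| RPrec n (f : recfun n) (g : recfun n.+2) : recfun n.+1
| RMu n (f : recfun n.+1) : recfun n.

(* [computes f x y]: the partial function [f] is defined at [x], with value
   [y].  The equations for [RPrec f g] are
     h (0, x) = f x   and   h (i + 1, x) = g (i, h (i, x), x). *)
Fixpoint computes (n : nat) (f : recfun n) : n.-tuple nat -> nat -> Prop :=
  match f in recfun n return n.-tuple nat -> nat -> Prop with
  | RZero _ => fun _ y => y = 0
  | RSucc => fun x y => y = (thead x).+1
  | RProj _ i => fun x y => y = tnth x i
  | RComp m _ f g => fun x y =>
      exists2 z : m.-tuple nat,
        forall i, computes (g i) x (tnth z i) & computes f z y
  | RPrec n f g => fun x y =>
      let x' : n.-tuple nat := [tuple of behead x] in
      exists h : nat -> nat,
        [/\ computes f x' (h 0),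
            forall i, i < thead x ->
              computes g [tuple of i :: h i :: x'] (h i.+1)
          & y = h (thead x)]
  | RMu _ f => fun x y =>
      computes f [tuple of y :: x] 0 /\
      forall i, i < y -> exists z, computes f [tuple of i :: x] z.+1
  end.

(** * Decision problems *)

Record problem : Type := Problem {
  instance : Type;
  encode : instance -> nat;
  yes_instance : instance -> Prop
}.

Definition decidable (P : problem) : Prop :=
  exists f : recfun 1, forall x : instance P,
    (yes_instance x -> computes f [tuple encode x] 1) /\
    (~ yes_instance x -> computes f [tuple encode x] 0).

Definition undecidable (P : problem) : Prop := ~ decidable P.

(** * The threshold edit distance problem *)

(* Elements of a finite type are represented by their rank, and finite lists
   of numbers by the Goedel numbering [CodeSeq.code] of [seq nat]. *)
Definition rank (T : finType) (x : T) : nat := enum_rank x.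

Definition encode_seq (T : finType) (s : seq T) : nat :=
  CodeSeq.code [seq rank x | x <- s].

Section Encoding.
Variables (Sigma : finType) (A : pda Sigma).

Definition encode_trans
    (t : state A * Sigma * option (stack_sym A) * state A
         * seq (stack_sym A)) : nat :=
  let: (q, s, a, q', u) := t in
  CodeSeq.code [:: rank q; rank s; if a is Some b then (rank b).+1 else 0;
                   rank q'; encode_seq u].

Definition encode_pda : nat :=
  CodeSeq.code [:: #|stack_sym A|; #|state A|; encode_seq (enum (initial A));
                   CodeSeq.code [seq encode_trans t | t <- trans A];
                   encode_seq (enum (final A))].

End Encoding.

Record ted_instance (C1 C2 : automata_class) : Type := TedInstance {
  alphabet : finType;
  aut1 : pda alphabet;
  aut2 : pda alphabet;
  threshold : nat;
  aut1_in : in_class C1 aut1;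
  aut2_in : in_class C2 aut2
}.

Definition encode_ted (C1 C2 : automata_class) (I : ted_instance C1 C2) : nat :=
  CodeSeq.code [:: #|alphabet I|; encode_pda (aut1 I); encode_pda (aut2 I);
                   threshold I].

Definition TED (R : realType) (C1 C2 : automata_class) : problem :=
  {| instance := ted_instance C1 C2;
     encode := @encode_ted C1 C2;
     yes_instance := fun I =>
       (lang_ed R (language (aut1 I)) (language (aut2 I))
          <= ((threshold I)%:R : R)%R%:E)%E |}.

(* Main.v *)
(* A history of a deterministic map [col] on numbers is a word
   [a^n0 # a^n1 # ... # a^nk #].  When [col] is affine on each residue class, a
   DPDA can compare two consecutive blocks, provided that it is told which ones:
   this is done by one extra letter, inserted in a faulty history.  Hence a
   history is at distance at most 1 from the language of the DPDA if and only if
   it is faulty; a parity constraint on the length excludes that a letter of a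
   correct history is replaced by a mark.  Partial recursive functions are
   compiled to counter programs, and these to Fractran programs, whose steps are
   affine on residue classes.  For the diagonal argument, suppose that [f]
   decides the problem, and compile the program that applies [f] to an instance
   built from its input [n].  Apart from the length [start n] of the first block, which is
   checked by the DFA, that instance depends only on the code of the
   transitions of the DPDA; taking this code as [n], and also as the number of
   states, makes [n |-> instance] a simple arithmetic function. *)
From HB Require Import structures.
From mathcomp Require Import all_boot all_order all_algebra.
From mathcomp Require Import boolp classical_sets reals ereal.
From mathcomp Require Import zify.
Require Import Defs.
Set Implicit Arguments.
Unset Strict Implicit.
Unset Printing Implicit Defensive.

Import Order.TTheory GRing.Theory Num.Theory.

(** * Counter programs *)

Definition upd (st : nat -> nat) (r v : nat) : nat -> nat :=
  fun i => if i == r then v else st i.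

(* [Loop r p] stands for [while r > 0 { r := r - 1; p }]. *)
Inductive prog := Inc of nat | Clr of nat | Seq of prog & prog | Loop of nat & prog.

Inductive exec : prog -> (nat -> nat) -> (nat -> nat) -> Prop :=
| exec_inc r st : exec (Inc r) st (upd st r (st r).+1)
| exec_clr r st : exec (Clr r) st (upd st r 0)
| exec_seq p q st1 st2 st3 :
    exec p st1 st2 -> exec q st2 st3 -> exec (Seq p q) st1 st3
| exec_loop0 r p st : st r = 0 -> exec (Loop r p) st st
| exec_loopS r p v st st1 st2 :
    st r = v.+1 -> exec p (upd st r v) st1 -> exec (Loop r p) st1 st2 ->
    exec (Loop r p) st st2.

(** The invariant is indexed by the number of rounds left: the body starts with [r] already
    decremented and must leave it at that value. *)
Lemma exec_loop_inv r p (I : nat -> (nat -> nat) -> Prop) :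
  (forall v st, I v.+1 st -> st r = v.+1 ->
     exists st', [/\ exec p (upd st r v) st', I v st' & st' r = v]) ->
  forall v st, I v st -> st r = v ->
    exists2 st', exec (Loop r p) st st' & I 0 st' /\ st' r = 0.
Proof.
move=> step; elim=> [|v IH] st Ist str.
  by exists st; [exact: exec_loop0 | split].
have [st1 [e1 I1 r1]] := step _ _ Ist str.
have [st2 e2 I2] := IH _ I1 r1.
by exists st2 => //; apply: exec_loopS e2; eauto.
Qed.

(** A loop destroys its counter, so [src] is drained into both [dst] and [tmp], and [tmp] is then
    drained back. *)
Definition copy (src dst tmp : nat) : prog :=
  Seq (Clr dst) (Seq (Clr tmp)
    (Seq (Loop src (Seq (Inc dst) (Inc tmp))) (Loop tmp (Inc src)))).

Lemma exec_copy src dst tmp st :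
  src != dst -> src != tmp -> dst != tmp ->
  exists st', [/\ exec (copy src dst tmp) st st', st' dst = st src
    & forall r, r != dst -> r != tmp -> st' r = st r].
Proof.
move=> /eqP nsd /eqP nst /eqP ndt.
set st1 := upd (upd st dst 0) tmp 0.
have [|||st2 e2 [[d2 [t2 o2]] s2]] := @exec_loop_inv src
    (Seq (Inc dst) (Inc tmp))
    (fun v s => s dst + v = st src /\ (s tmp + v = st src /\
        forall r, r <> src -> r <> dst -> r <> tmp -> s r = st r))
    _ (st src) st1.
- move=> v s [d1 [t1 o1]] s1.
  exists (upd (upd (upd s src v) dst (s dst).+1) tmp (s tmp).+1).
  split.
  + apply: exec_seq; first exact: exec_inc.
    have -> : (s tmp).+1 = (upd (upd s src v) dst
        (upd s src v dst).+1 tmp).+1.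
      by rewrite /upd; do !case: eqP => //; lia.
    have -> : s dst = upd s src v dst by rewrite /upd; case: eqP; lia.
    exact: exec_inc.
  + rewrite /upd !eqxx; split; first by case: eqP; lia.
    split; first lia.
    by move=> r r1 r2 r3; do !case: eqP => //; auto.
  + by rewrite /upd; do !case: eqP => //; lia.
- rewrite /st1 /upd !eqxx; split; first by case: eqP; lia.
  by split; first lia; move=> r r1 r2 r3; do !case: eqP => //.
- by rewrite /st1 /upd; do !case: eqP => //; lia.
have [||st3 e3 [[s3 [d3 o3]] t3]] := @exec_loop_inv tmp (Inc src)
    (fun v s => s src + v = st src /\ (s dst = st src /\
        forall r, r <> src -> r <> dst -> r <> tmp -> s r = st r))
    _ (st2 tmp) st2 _ erefl; last first.
- exists st3; split => //.
    apply: exec_seq; first exact: exec_clr.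
    apply: exec_seq; first exact: exec_clr.
    by apply: exec_seq; eauto.
  move=> r /eqP rd /eqP rt; have [->|/eqP rs] := eqVneq r src; first lia.
  exact: o3.
- by split; first lia; split; first lia.
move=> v s [d1 [t1 o1]] s1.
exists (upd (upd s tmp v) src (s src).+1); split.
+ have -> : s src = upd s tmp v src by rewrite /upd; case: eqP; lia.
  exact: exec_inc.
+ split; first by rewrite /upd eqxx; lia.
  split; first by rewrite /upd; do !case: eqP => //; lia.
  by move=> r r1 r2 r3; rewrite /upd; do !case: eqP => //; auto.
+ by rewrite /upd; do !case: eqP => //; lia.
Qed.

(** Arguments are read from [ins], the value goes to [out], and registers from [base] on are
    scratch. For [RMu], the loop on [t] is a conditional, since its body clears [t]: a nonzero value
    sets [flag] again. *)
Fixpoint prog_of n (f : recfun n) (ins : seq nat) (out base : nat) : prog :=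
  match f with
  | RZero _ => Clr out
  | RSucc => Seq (copy (nth 0 ins 0) out base) (Inc out)
  | RProj _ i => copy (nth 0 ins i) out base
  | RComp m _ f g =>
      foldr (fun i => Seq (prog_of (g i) ins (base + i) (base + m)))
            (prog_of f (iota base m) out (base + m)) (enum 'I_m)
  | RPrec _ f g =>
      let i := base in let acc := base.+1 in
      let cnt := base.+2 in let res := base.+3 in let base' := base.+4 in
      Seq (prog_of f (behead ins) acc base')
      (Seq (Clr i)
      (Seq (copy (nth 0 ins 0) cnt base')
      (Seq (Loop cnt
              (Seq (prog_of g [:: i, acc & behead ins] res base')
              (Seq (copy res acc base') (Inc i))))
           (copy acc out base'))))
  | RMu _ f =>
      let y := base in let t := base.+1 in
      let flag := base.+2 in let base' := base.+3 in
      Seq (Clr y) (Seq (Clr flag) (Seq (Inc flag)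
      (Seq (Loop flag
              (Seq (prog_of f (y :: ins) t base')
                   (Loop t (Seq (Clr t) (Seq (Inc y) (Inc flag))))))
           (copy y out base'))))
  end.

Definition below (b : nat) (s : seq nat) := all (fun i => i < b) s.

Lemma below_leq b b' s : below b s -> b <= b' -> below b' s.
Proof. by move=> /allP bs bb; apply/allP => i /bs; lia. Qed.

Lemma eq_map_below (st st' : nat -> nat) b s :
  below b s -> (forall r, r < b -> st' r = st r) -> map st' s = map st s.
Proof. by move=> /allP bs e; apply/eq_in_map => i /bs; apply: e. Qed.

(* The program does not assume that the registers from [base] on are cleared. *)
Theorem exec_prog_of n (f : recfun n) ins out base (st : nat -> nat)
    (x : n.-tuple nat) y :
  below base ins -> out < base -> out \notin ins ->
  map st ins = x -> computes f x y ->
  exists st', [/\ exec (prog_of f ins out base) st st', st' out = y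
    & forall r, r < base -> r != out -> st' r = st r].
Proof.
elim: f ins out base st x y =>
  [{}n | | {}n i | m {}n f IHf g IHg | {}n f IHf g IHg | {}n f IHf]
  ins out base st x y insb outb outi stx.
- move=> /= ->; exists (upd st out 0); split; first exact: exec_clr.
    by rewrite /upd eqxx.
  by move=> r _ /negPf ro; rewrite /upd ro.
- move=> /= ->; case: ins insb outi stx => [|a [|? ?]];
    try by move=> _ _ stx; move: (size_tuple x); rewrite -stx.
  rewrite /below /=.
  rewrite andbT inE => ab /negPf oa stx.
  have [|||st1 [e1 o1 r1]] := @exec_copy a out base st; try lia.
  exists (upd st1 out (st1 out).+1); split.
  + by apply: exec_seq e1 _; exact: exec_inc.
  + by rewrite /upd eqxx o1 /thead (tnth_nth 0) -stx.
  + move=> r rb ro; rewrite /upd (negPf ro) r1 //; lia.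
- move=> /= ->; have ii : i < size ins.
    by rewrite -(size_map st) stx size_tuple.
  have ai : nth 0 ins i \in ins by exact: mem_nth.
  have ab := allP insb _ ai.
  have ao : nth 0 ins i != out by apply: contraNneq outi => <-.
  have [||//|st1 [e1 o1 r1]] := @exec_copy (nth 0 ins i) out base st => //; try lia.
  exists st1; split => //; first by rewrite o1 (tnth_nth 0) -stx (nth_map 0).
  by move=> r rb ro; rewrite r1 //; lia.
- move=> /= [z gz fz].
  (* [s] lists the components still to be computed; the values of the others already sit in their
     registers. *)
  suff H : forall (s : seq 'I_m) st1, uniq s -> map st1 ins = x ->
     (forall i, i \notin s -> st1 (base + i) = tnth z i) ->
     exists st', [/\ exec (foldr
        (fun i => Seq (prog_of (g i) ins (base + i) (base + m)))
            (prog_of f (iota base m) out (base + m)) s) st1 st', st' out = y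
        & forall r, r < base -> r != out -> st' r = st1 r].
    by apply: H => //; [exact: enum_uniq | move=> i; rewrite mem_enum].
  elim=> [|i s IH] st1 /= us st1x zs.
    have [|||||st' [e' o' r']] := IHf (iota base m) out (base + m) st1 z y => //.
    + by apply/allP => k; rewrite mem_iota; lia.
    + lia.
    + by rewrite mem_iota; lia.
    + apply: (@eq_from_nth _ 0); first by rewrite size_map size_iota size_tuple.
      rewrite size_map size_iota => k km.
      rewrite (nth_map 0) ?size_iota // nth_iota //.
      by rewrite (zs (Ordinal km)) // (tnth_nth 0).
    + by exists st'; split => // r rb ro; apply: r' => //; lia.
  case/andP: us => is_ us.
  have [|||||st2 [e2 o2 r2]] :=
    IHg i ins (base + i) (base + m) st1 x (tnth z i) => //.
  + by apply: below_leq insb _; lia.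
  + by have := ltn_ord i; lia.
  + by apply/negP => /(allP insb); lia.
  have [|||st' [e' o' r']] := IH st2 => //.
  + rewrite -st1x; apply: eq_map_below insb _ => r rb.
    by apply: r2; lia.
  + move=> k ks; have [->|ki] := eqVneq k i; first by rewrite o2.
    have ki' : (k : nat) != i by [].
    rewrite r2; [|by have := ltn_ord k; lia|by lia].
    by apply: zs; rewrite inE negb_or ki.
  exists st'; split => //; first exact: exec_seq e2 e'.
  by move=> r rb ro; rewrite r' // r2 //; lia.
- move=> /= [h [h0 hS ->]].
  case: ins insb outi stx => [|a ins].
    by move=> _ _ /= stx; move: (size_tuple x); rewrite -stx.
  case/tupleP: x h0 hS => x0 x; rewrite theadE => h0 hS'.
  have eqx : [tuple of behead [tuple of x0 :: x]] = x by apply: val_inj.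
  rewrite eqx in h0 => /=.
  have {hS'}hS i : i < x0 -> computes g [tuple of [:: i, h i & x]] (h i.+1).
    move=> /hS'; set t1 := [tuple of _]; set t2 := [tuple of _].
    by have -> : t1 = t2 by apply: val_inj.
  move=> /andP[ab insb]; rewrite inE negb_or => /andP[oa oi] [sta stx].
  have insb' : below base.+4 ins by apply: below_leq insb _; lia.
  have nin k : base <= k -> k \notin ins.
    by move=> bk; apply/negP => /(allP insb); lia.
  have [|||||st1 [e1 o1 r1]] := IHf ins base.+1 base.+4 st x (h 0) => //; first lia.
    exact: nin.
  set st2 := upd st1 base 0.
  have st2E r : r < base -> st2 r = st r.
    by move=> rb; rewrite /st2 /upd; case: eqP => [|_]; [lia|apply: r1; lia].
  have [|||st3 [e3 o3 r3]] := @exec_copy a base.+2 base.+4 st2; try lia.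
  (* With [v] rounds left, [x0 - v] rounds have been made. *)
  pose I v s := [/\ s base.+1 = h (x0 - v), s base = x0 - v, v <= x0
     & forall r, r < base -> s r = st r].
  have [||//|st4 e4 [[o4 i4 _ r4] c4]] := @exec_loop_inv base.+2
      (Seq (prog_of g [:: base, base.+1 & ins] base.+3 base.+4)
              (Seq (copy base.+3 base.+1 base.+4) (Inc base))) I _ x0 st3.
  + move=> v s [sa si vx sr] sc.
    have sr' r : r < base -> upd s base.+2 v r = st r.
      by move=> rb; rewrite /upd -sr //; case: eqP => //; lia.
    have [|||||t1 [f1 q1 u1]] := IHg [:: base, base.+1 & ins] base.+3 base.+4
         (upd s base.+2 v) [tuple of [:: x0 - v.+1, h (x0 - v.+1) & x]]
         (h (x0 - v.+1).+1) => //.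
    * by apply/allP => k; rewrite !inE => /or3P[/eqP->|/eqP->|/(allP insb)]; lia.
    * by rewrite !inE !negb_or; apply/and3P; split; [lia|lia|apply: nin; lia].
    * rewrite /= (eq_map_below insb sr') stx.
      have -> : upd s base.+2 v base = x0 - v.+1.
        by rewrite /upd -si; case: eqP => //; lia.
      by have -> : upd s base.+2 v base.+1 = h (x0 - v.+1)
        by rewrite /upd -sa; case: eqP => //; lia.
    * by apply: hS; lia.
    have [|||t2 [f2 q2 u2]] := @exec_copy base.+3 base.+1 base.+4 t1; try lia.
    exists (upd t2 base (t2 base).+1); split.
    * apply: exec_seq f1 _; apply: exec_seq f2 _; exact: exec_inc.
    * have q3 : t2 base = x0 - v.+1.
        rewrite u2 ?u1; try lia.
        by rewrite /upd -si; case: eqP => //; lia.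
      split; rewrite /upd ?eqxx ?q3; try lia.
        by case: eqP; [lia|]; rewrite q2 q1 => _; congr h; lia.
      move=> r rb; case: eqP; [lia|] => _; rewrite u2 ?u1 ?sr' //; lia.
    * rewrite /upd; case: eqP; [lia|] => _; rewrite u2 ?u1; try lia.
      by rewrite /upd eqxx.
  + split; rewrite ?subnn //.
    * rewrite r3; try lia.
      by rewrite /st2 /upd; case: eqP; [lia|].
    * rewrite r3; try lia.
      by rewrite /st2 /upd eqxx.
    * by move=> r rb; rewrite r3 ?st2E //; lia.
  + by rewrite o3 st2E.
  have [|||st5 [e5 o5 r5]] := @exec_copy base.+1 out base.+4 st4; try lia.
  exists st5; split.
  + apply: exec_seq e1 _; apply: exec_seq; first exact: exec_clr.
    by apply: exec_seq e3 _; apply: exec_seq e4 _.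
  + by rewrite o5 o4 subn0.
  + by move=> r rb ro; rewrite r5 ?r4 //; lia.
- move=> /= [fy fz].
  set body := Seq (prog_of f _ _ _) _.
  (* [v] counts the candidates that still fail before [y], so the current candidate is [y - v]. *)
  suff H : forall v st1, v <= y -> st1 base = y - v -> st1 base.+2 = 1 ->
     (forall r, r < base -> st1 r = st r) ->
     exists st', [/\ exec (Loop base.+2 body) st1 st', st' base = y
      & forall r, r < base -> st' r = st r].
    have [||||st1 [e1 o1 r1]] := H y (upd (upd (upd st base 0) base.+2 0) base.+2 1).
    + by [].
    + by rewrite /upd subnn eqxx; do !case: eqP => //; lia.
    + by rewrite /upd eqxx.
    + by move=> r rb; rewrite /upd; do !case: eqP => //; lia.
    have [|||st2 [e2 o2 r2]] := @exec_copy base out base.+3 st1; try lia.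
    exists st2; split.
    + apply: exec_seq; first exact: exec_clr.
      apply: exec_seq; first exact: exec_clr.
      apply: exec_seq; last exact: exec_seq e1 e2.
      have -> : 1 = (upd (upd st base 0) base.+2 0 base.+2).+1.
        by rewrite /upd eqxx.
      exact: exec_inc.
    + by rewrite o2 o1.
    + by move=> r rb ro; rewrite r2 ?r1 //; lia.
  have run_f v s z : computes f [tuple of y - v :: x] z -> s base = y - v ->
     (forall r, r < base -> s r = st r) ->
     exists st', [/\ exec (prog_of f (base :: ins) base.+1 base.+3)
        s st', st' base.+1 = z
        & forall r, r < base.+3 -> r != base.+1 -> st' r = s r].
    move=> fv sb sr; apply: IHf fv.
    + rewrite /below /=; apply/andP; split; first lia.
      by apply: below_leq insb _; lia.
    + lia.
    + rewrite inE negb_or; apply/andP; split; first lia.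
      by apply/negP => /(allP insb); lia.
    + by rewrite /= sb (eq_map_below insb sr) stx.
  elim=> [|v IH] st1 vy s1 fl1 r1.
    have [|||t [et ot rt]] := run_f 0 (upd st1 base.+2 0) 0.
    + by rewrite subn0.
    + by rewrite -s1 /upd; case: eqP => //; lia.
    + by move=> r rb; rewrite -r1 // /upd; case: eqP => //; lia.
    have t2 : t base.+2 = 0 by rewrite rt ?/upd ?eqxx //; lia.
    exists t; split.
    + apply: exec_loopS fl1 _ (exec_loop0 _ t2).
      apply: exec_seq et _; exact: exec_loop0.
    + rewrite rt; try lia.
      by rewrite /upd; case: eqP => //; lia.
    + move=> r rb; rewrite rt; try lia.
      by rewrite /upd; case: eqP => [|_]; [lia|apply: r1].
  have [|z fz1] := fz (y - v.+1); first lia.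
  have [||t [et ot rt]] := run_f v.+1 (upd st1 base.+2 0) z.+1 fz1.
  + by rewrite -s1 /upd; case: eqP => //; lia.
  + by move=> r rb; rewrite -r1 // /upd; case: eqP => //; lia.
  set t1 := upd (upd t base.+1 z) base.+1 0.
  set t2 := upd t1 base (t1 base).+1.
  set t3 := upd t2 base.+2 (t2 base.+2).+1.
  have tE r : r < base.+3 -> r != base.+1 -> t1 r = upd st1 base.+2 0 r.
    by move=> rb ra; rewrite -rt // /t1 /upd (negPf ra).
  have [|||| st' [e' o' r']] := IH t3; try lia.
  + rewrite /t3 /t2 /upd; case: eqP => [|_]; first lia.
    rewrite eqxx tE; try lia.
    by rewrite /upd; case: eqP => //; lia.
  + rewrite /t3 {1}/upd eqxx /t2 {1}/upd; case: eqP => [|_]; first lia.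
    rewrite tE; try lia.
    by rewrite /upd eqxx.
  + move=> r rb; rewrite /t3 {1}/upd; case: eqP => [|_]; first lia.
    rewrite /t2 {1}/upd; case: eqP => [|_]; first lia.
    rewrite tE; try lia.
    by rewrite /upd; case: eqP => [|_]; [lia|apply: r1].
  exists st'; split => //.
  apply: exec_loopS fl1 _ e'.
  apply: exec_seq et _.
  apply: exec_loopS ot _ _.
    apply: exec_seq; first exact: exec_clr.
    apply: exec_seq; exact: exec_inc.
  apply: exec_loop0; rewrite -/t1 -/t2 -/t3 /t3 {1}/upd.
  case: eqP => [|_]; first lia.
  rewrite /t2 {1}/upd; case: eqP => [|_]; first lia.
  by rewrite /t1 /upd eqxx.
Qed.

(** * Fractran programs *)

(** The primes need not be consecutive. It matters that they are distinct and that [pr 0] is 2,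
    which ties register 0 to parity. *)
Definition pr (i : nat) : nat := iter i (fun m => s2val (prime_above m)) 2.

Lemma pr_prime i : prime (pr i).
Proof. by case: i => [|i] //=; case: prime_above. Qed.

Lemma pr_lt i j : i < j -> pr i < pr j.
Proof.
elim: j => // j IH; rewrite ltnS leq_eqVlt.
have jS : pr j < pr j.+1 by rewrite /=; case: prime_above.
by case/predU1P => [->|/IH] //; move/ltn_trans; apply.
Qed.

Lemma eq_pr i j : (pr i == pr j) = (i == j).
Proof.
by case: (ltngtP i j) => [/pr_lt|/pr_lt|->]; rewrite ?eqxx //;
  [move/ltn_eqF | move/gtn_eqF].
Qed.

Definition regp (r : nat) : nat := pr r.*2.
Definition labp (s : nat) : nat := pr s.*2.+1.

Lemma regp_prime r : prime (regp r). Proof. exact: pr_prime. Qed.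
Lemma labp_prime s : prime (labp s). Proof. exact: pr_prime. Qed.
Lemma regp_gt0 r : 0 < regp r. Proof. exact: prime_gt0 (regp_prime r). Qed.
Lemma labp_gt0 s : 0 < labp s. Proof. exact: prime_gt0 (labp_prime s). Qed.
Lemma eq_regp r r' : (regp r == regp r') = (r == r').
Proof. by rewrite eq_pr; apply/eqP/eqP; lia. Qed.
Lemma eq_labp s s' : (labp s == labp s') = (s == s').
Proof. by rewrite eq_pr; apply/eqP/eqP; lia. Qed.
Lemma labp_regp s r : (labp s == regp r) = false.
Proof. by rewrite eq_pr; apply/eqP; lia. Qed.

(* A rule [(den, num)] multiplies by [num / den]; the first applicable rule
   fires.  The fractions need not be reduced. *)
Fixpoint fmatch (L : seq (nat * nat)) (n : nat) : nat * nat :=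
  if L is ru :: L' then if ru.1 %| n then ru else fmatch L' n else (1, 1).

(** When no rule applies, [fmatch] returns the fraction 1/1, so a halted number is a fixed point. *)
Definition fstep L n := n %/ (fmatch L n).1 * (fmatch L n).2.

Fixpoint prog_size (p : prog) : nat :=
  match p with
  | Inc _ | Clr _ => 1
  | Seq p q => prog_size p + prog_size q
  | Loop _ p => (prog_size p).+1
  end.

(* [s] is the entry label and [e] the exit label. *)
Fixpoint rules (p : prog) (s e : nat) : seq (nat * nat) :=
  match p with
  | Inc r => [:: (labp s, regp r * labp e)]
  | Clr r => [:: (labp s * regp r, labp s); (labp s, labp e)]
  | Seq p q => rules p s (s + prog_size p) ++ rules q (s + prog_size p) e
  | Loop r p =>
      [:: (labp s * regp r, labp s.+1), (labp s, labp e) & rules p s.+1 s]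
  end.

Lemma rules_gt0 p s e : all (fun ru => (0 < ru.1) && (0 < ru.2)) (rules p s e).
Proof.
elim: p s e => [r|r|p IHp q IHq|r p IHp] s e /=; rewrite ?muln_gt0 ?labp_gt0 ?regp_gt0 //=.
by rewrite all_cat IHp IHq.
Qed.

Definition labels_lt (b : nat) (L : seq (nat * nat)) : Prop :=
  forall ru, ru \in L -> exists2 s, s < b & labp s %| ru.1.

(** Labels are allotted from [s] upwards, [prog_size p] of them; the exit label [e] is only put into
    numerators. *)
Lemma rules_labels p s e : labels_lt (s + prog_size p) (rules p s e).
Proof.
elim: p s e => [r|r|p IHp q IHq|r p IHp] s e ru /=.
- by rewrite inE => /eqP->; exists s; [lia|].
- by rewrite !inE => /orP[]/eqP->; exists s; rewrite ?dvdn_mulr //; lia.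
- by rewrite mem_cat => /orP[/IHp|/IHq] [k ks kd]; exists k => //; lia.
- rewrite !inE => /or3P[/eqP->|/eqP->|/IHp[k ks kd]]; last by exists k; lia.
    by exists s; rewrite ?dvdn_mulr //; lia.
  by exists s; [lia|].
Qed.

(** A Goedel number of a machine state: register contents are exponents, and exactly one label prime
    divides it, to the first power. *)
Definition rep (n s : nat) (st : nat -> nat) : Prop :=
  exists2 m, n = labp s * m
    & [/\ 0 < m, forall r, logn (regp r) m = st r & forall k, ~~ (labp k %| m)].

Lemma rep_labp n s st k : rep n s st -> (labp k %| n) = (k == s).
Proof.
case=> m -> [_ _ /(_ k)/negPf km].
by rewrite Euclid_dvdM ?labp_prime // km orbF dvdn_prime2 ?labp_prime // eq_labp.
Qed.

Lemma rep_regp n s st r : rep n s st -> (labp s * regp r %| n) = (0 < st r).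
Proof.
case=> m -> [m0 lm _]; rewrite dvdn_pmul2l ?labp_gt0 //.
by rewrite -lm logn_gt0 mem_primes regp_prime m0.
Qed.

Lemma regp_dvd_rep n s st r : rep n s st -> (regp r %| n) = (0 < st r).
Proof.
move=> H; rewrite -(rep_regp r H); case: H => m -> _.
rewrite dvdn_pmul2l ?labp_gt0 // Euclid_dvdM ?regp_prime //.
by rewrite dvdn_prime2 ?regp_prime ?labp_prime // eq_sym labp_regp.
Qed.

Lemma rep_goto n s st e : rep n s st -> rep (n %/ labp s * labp e) e st.
Proof.
case=> m -> H; exists m => //.
by rewrite mulKn ?labp_gt0 // mulnC.
Qed.

Lemma labp_regp_dvd k r : (labp k %| regp r) = false.
Proof. by rewrite dvdn_prime2 ?labp_prime ?regp_prime // labp_regp. Qed.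

Lemma rep_inc n s st r e : rep n s st ->
  rep (n %/ labp s * (regp r * labp e)) e (upd st r (st r).+1).
Proof.
case=> m -> [m0 lm nm]; exists (m * regp r).
  by rewrite mulKn ?labp_gt0 //; lia.
split=> [|k|k]; first by rewrite muln_gt0 m0 regp_gt0.
  rewrite lognM ?regp_gt0 // lm logn_prime ?regp_prime // eq_regp.
  by rewrite /upd; case: eqP => [->|_] /=; lia.
by rewrite Euclid_dvdM ?labp_prime // negb_or nm labp_regp_dvd.
Qed.

Lemma rep_dec n s st r v e : rep n s st -> st r = v.+1 ->
  rep (n %/ (labp s * regp r) * labp e) e (upd st r v).
Proof.
move=> H rv; have := rep_regp r H; rewrite rv ltnS leq0n.
case: H => m -> [m0 lm nm]; rewrite dvdn_pmul2l ?labp_gt0 //.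
case/dvdnP=> q mq; exists q.
  by rewrite mq (mulnC q) mulnA mulKn 1?mulnC // muln_gt0 labp_gt0 regp_gt0.
have q0 : 0 < q by move: m0; rewrite mq muln_gt0 => /andP[].
split=> // k.
  have := lm k; rewrite mq lognM ?regp_gt0 //.
  rewrite (@logn_prime _ (regp r)) ?regp_prime // eq_regp.
  by rewrite /upd; case: eqP => [->|_] /=; lia.
by have := nm k; rewrite mq Euclid_dvdM ?labp_prime // negb_or => /andP[].
Qed.

(** Each rule of [L1] tests a label below [b], whereas the only label prime dividing [n] is that of
    [s >= b]. *)
Lemma fmatch_skip L1 L2 b s n st :
  labels_lt b L1 -> b <= s -> rep n s st -> fmatch (L1 ++ L2) n = fmatch L2 n.
Proof.
elim: L1 => //= ru L1 IH lab bs H.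
case: ifP => [run|_]; last first.
  by apply: IH => // ru' ru'L; apply: lab; rewrite inE ru'L orbT.
have [k kb kd] : exists2 k, k < b & labp k %| ru.1.
  by apply: lab; rewrite inE eqxx.
have := rep_labp k H; rewrite (dvdn_trans kd run).
by move/esym/eqP => ks; lia.
Qed.

Lemma labels_ltW b b' L : labels_lt b L -> b <= b' -> labels_lt b' L.
Proof. by move=> lab bb ru /lab[k kb kd]; exists k => //; lia. Qed.

(** The context [L1], [L2] lets the induction reach subprograms: rules before those of [p] have
    smaller labels and cannot fire, and rules after them are shadowed, because every label of [p]
    has an applicable rule. *)
Theorem fstep_rules p st st' : exec p st st' ->
  forall s e L1 L2 n, labels_lt s L1 -> rep n s st ->
  exists k, rep (iter k (fstep (L1 ++ rules p s e ++ L2)) n) e st'.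
Proof.
elim=> {p st st'}
  [r st|r st|p q st1 st2 st3 _ IHp _ IHq|r p st st0|r p v st st1 st2 stv _ IHp _ IHl]
  s e L1 L2 n labs repn.
- exists 1; rewrite /= /fstep (fmatch_skip _ labs _ repn) //=.
  by rewrite (rep_labp s repn) eqxx; exact: rep_inc.
- set L := L1 ++ _.
  (* Clearing takes one step per unit of [r], so the content of [r] is generalised. *)
  suff H : forall v st', st' r = v -> (forall r', r' != r -> st' r' = st r') ->
      forall n, rep n s st' -> exists k, rep (iter k (fstep L) n) e (upd st r 0).
    exact: H repn.
  elim=> [|v IHv] st' str sto n' repn'.
    exists 1; rewrite /= /fstep (fmatch_skip _ labs _ repn') //=.
    rewrite (rep_regp r repn') str /= (rep_labp s repn') eqxx.
    have [m mE [m0 lm nm]] := rep_goto e repn'.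
    exists m => //; split=> // r'; rewrite lm /upd.
    by case: eqP => [->//|/eqP/sto].
  have [||k Hk] := IHv (upd st' r v) _ _ _ (rep_dec s repn' str).
  + by rewrite /upd eqxx.
  + by move=> r' rr; rewrite /upd (negPf rr) sto.
  exists k.+1; rewrite iterSr {2}/fstep (fmatch_skip _ labs _ repn') //=.
  by rewrite (rep_regp r repn') str.
- have [k1 H1] := IHp s (s + prog_size p) L1 (rules q (s + prog_size p) e ++ L2)
     n labs repn.
  have [|k2 H2] := IHq (s + prog_size p) e (L1 ++ rules p s (s + prog_size p)) L2
     _ _ H1.
    move=> ru; rewrite mem_cat => /orP[|/rules_labels//].
    by apply: (labels_ltW labs); lia.
  exists (k2 + k1); rewrite iterD /= -catA.
  by rewrite -[X in fstep X](catA L1) in H2.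
- exists 1; rewrite /= /fstep (fmatch_skip _ labs _ repn) //=.
  rewrite (rep_regp r repn) st0 /= (rep_labp s repn) eqxx.
  exact: rep_goto.
- set rs := [:: (labp s * regp r, labp s.+1); (labp s, labp e)].
  have [|k1 H1] := IHp s.+1 s (L1 ++ rs) L2 _ _ (rep_dec s.+1 repn stv).
    move=> ru; rewrite mem_cat !inE => /or3P[/labs|/eqP->|/eqP->].
    + by case=> k ks kd; exists k => //; lia.
    + by exists s; rewrite ?dvdn_mulr.
    + by exists s.
  rewrite -catA in H1.
  have [k2 H2] := IHl s e L1 L2 _ labs H1.
  exists (k2 + k1.+1); rewrite iterD iterSr {3}/fstep.
  rewrite (fmatch_skip _ labs _ repn) //= (rep_regp r repn) stv /=.
  exact: H2.
Qed.

Lemma fstep_halt p e n st : prog_size p <= e -> rep n e st ->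
  fstep (rules p 0 e) n = n.
Proof.
move=> pe repn; rewrite /fstep.
have lab : labels_lt (prog_size p) (rules p 0 e) by exact: rules_labels.
rewrite -[rules p 0 e]cats0 (fmatch_skip _ lab pe repn) /=.
by rewrite divn1 muln1.
Qed.

(** * Computable functions *)

Definition computable n (F : n.-tuple nat -> nat) : Prop :=
  exists f : recfun n, forall x, computes f x (F x).

Lemma computable_const n c : computable (fun _ : n.-tuple nat => c).
Proof.
elim: c => [|c [f fc]]; first by exists (RZero n).
exists (RComp RSucc (fun _ : 'I_1 => f)) => x.
by exists [tuple c] => // i; rewrite (tnth_nth 0) (ord1 i); apply: fc.
Qed.

Lemma computable_tnth n (i : 'I_n) : computable (fun x => tnth x i).
Proof. by exists (RProj i). Qed.

Definition computable1 (G : nat -> nat) : Prop :=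
  computable (fun x : 1.-tuple nat => G (thead x)).

Definition computable2 (G : nat -> nat -> nat) : Prop :=
  computable (fun x : 2.-tuple nat => G (tnth x ord0) (tnth x ord_max)).

Lemma computable_comp1 n (G : nat -> nat) (F : n.-tuple nat -> nat) :
  computable1 G -> computable F -> computable (fun x => G (F x)).
Proof.
move=> [g gG] [f fF]; exists (RComp g (fun _ : 'I_1 => f)) => x.
exists [tuple F x]; last by have := gG [tuple F x].
by move=> i; rewrite (tnth_nth 0) (ord1 i); apply: fF.
Qed.

Lemma computable_comp2 n (G : nat -> nat -> nat) (F1 F2 : n.-tuple nat -> nat) :
  computable2 G -> computable F1 -> computable F2 ->
  computable (fun x => G (F1 x) (F2 x)).
Proof.
move=> [g gG] [f1 fF1] [f2 fF2].
exists (RComp g (fun i : 'I_2 => if i == ord0 then f1 else f2)) => x.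
exists [tuple F1 x; F2 x]; last by have := gG [tuple F1 x; F2 x].
by case=> [[|[|i]] Hi] //=.
Qed.

Lemma computable_rec n (H : nat -> n.-tuple nat -> nat) F G :
  computable F -> computable G -> (forall x, H 0 x = F x) ->
  (forall i x, H i.+1 x = G [tuple of i :: H i x :: x]) ->
  computable (fun x : n.+1.-tuple nat => H (thead x) [tuple of behead x]).
Proof.
move=> [f fF] [g gG] H0 HS; exists (RPrec f g) => x.
exists (fun i => H i [tuple of behead x]); split=> //; first by rewrite H0.
by move=> i _; rewrite HS.
Qed.

Lemma computable_S : computable1 succn.
Proof. by exists RSucc. Qed.

Lemma computable1_rec (h : nat -> nat) (g : nat -> nat -> nat) :
  computable2 g -> (forall i, h i.+1 = g i (h i)) -> computable1 h.
Proof.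
move=> cg hS; apply: (@computable_rec 0 (fun i _ => h i) (fun=> h 0)
  (fun x : 2.-tuple nat => g (tnth x ord0) (tnth x ord_max))) => //.
exact: computable_const.
Qed.

Lemma computable1_iter (h g : nat -> nat) :
  computable1 g -> (forall i, h i.+1 = g (h i)) -> computable1 h.
Proof.
move=> cg hS; apply: (@computable1_rec h (fun _ => g)) => //.
apply: (computable_comp1 (F := fun x : 2.-tuple nat => tnth x ord_max)) => //.
exact: computable_tnth.
Qed.

Lemma computable_double : computable1 double.
Proof.
apply: (@computable1_iter double (fun n => n.+2)) => //.
by do 2 apply: (computable_comp1 computable_S); exact: computable_tnth.
Qed.

(** [CodeSeq.code (a :: s)] unfolds to [cns a (CodeSeq.code s)], so the code of a list of fixed
    length is a composition of [cns]. *)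
Definition cns (a b : nat) : nat := 2 ^ a * b.*2.+1.

Lemma computable_cns : computable2 cns.
Proof.
have [||||f fP] := @computable_rec 1 (fun i x => cns i (thead x))
  (fun x => (thead x).*2.+1) (fun x => (tnth x (lift ord0 ord0)).*2).
- apply: (computable_comp1 computable_S).
  exact: (computable_comp1 computable_double (computable_tnth _)).
- exact: (computable_comp1 computable_double (computable_tnth _)).
- by move=> x; rewrite /cns mul1n.
- by move=> i x; rewrite (tnth_nth 0) /= /cns expnS -mulnA mul2n.
exists f => x; have := fP x; congr (computes f x (cns _ _)).
by case/tupleP: x => a x; case/tupleP: x => b x; rewrite !(tnth_nth 0).
Qed.


(** * Certifying an error in a history by one mark *)

(** [Pre] is the search for the mark: the residue modulo [P] of the position in the block, and
    whether [P] letters of it have passed. [Push] reads the rest of the marked block, stacking one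
    symbol per [P] letters. [Cmp f r j] reads the next block, removing one symbol per [c r] letters;
    [j] counts letters since the last removal. [Expt] awaits the closing letter of the last block
    and [End] the end of the word; [Acc] has certified a wrong step. *)
Inductive phase :=
| Pre of bool & nat
| Push of bool & nat
| Cmp of bool & nat & nat
| Expt
| Acc
| End
| Dead.

Definition of_phase (ph : phase) : nat * bool * nat * nat :=
  match ph with
  | Pre f r => (0, f, r, 0)
  | Push f r => (1, f, r, 0)
  | Cmp f r j => (2, f, r, j)
  | Expt => (3, false, 0, 0)
  | Acc => (4, false, 0, 0)
  | End => (5, false, 0, 0)
  | Dead => (6, false, 0, 0)
  end.

Definition to_phase (x : nat * bool * nat * nat) : phase :=
  let: (k, f, r, j) := x in
  match k with
  | 0 => Pre f r | 1 => Push f r | 2 => Cmp f r j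
  | 3 => Expt | 4 => Acc | 5 => End | _ => Dead
  end.

Lemma of_phaseK : cancel of_phase to_phase. Proof. by case. Qed.

HB.instance Definition _ := Equality.copy phase (can_type of_phaseK).

(* Letters: 0 is a counting letter, 1 closes a block, 2 marks a wrong step and
   3 marks a block that is last and not accepting. *)
Definition blocks (ns : seq nat) : seq nat :=
  flatten [seq rcons (nseq n 0) 1 | n <- ns].

Lemma blocks_cons n ns : blocks (n :: ns) = nseq n 0 ++ 1 :: blocks ns.
Proof. by rewrite /blocks /= cat_rcons. Qed.

Section Checker.

Variables (P B : nat) (c d : nat -> nat) (acc : pred nat).
Hypothesis P_gt0 : 0 < P.
Hypothesis c_gt0 : forall r, r < P -> 0 < c r.
Hypothesis c_leB : forall r, r < P -> c r <= B.
Hypothesis d_ltB : forall r, r < P -> d r < B.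

(** A generalised Collatz map: on the class of [r] modulo [P] it is affine, sending [P * t + r] to
    [c r * t + d r]. *)
Definition col (n : nat) : nat := c (n %% P) * (n %/ P) + d (n %% P).

(* A block [n = P * t + r] must be followed by [c r * t + d r].  Without flag
   the mark precedes the whole block and the next block is [c r * t + j] with
   [j != d r]; with flag it comes after [P * i] letters, [i > 0], and the next
   block is [c r * (t - i) + j] with [j < c r]. *)
Definition bad (f : bool) (r j : nat) : bool := if f then j < c r else j != d r.

(* The second component is the number of symbols replacing the top symbol,
   if [top], or put on the empty stack otherwise. *)
Definition pstep (ph : phase) (x : nat) (top : bool) : phase * nat :=
  match ph, x with
  | Pre f r, 0 => (Pre (f || (r.+1 == P)) (r.+1 %% P), top : nat)
  | Pre f r, 1 => (Pre false 0, top : nat)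
  | Pre f r, 2 => (if r == 0 then Push f 0 else Dead, top : nat)
  | Pre f r, 3 => (if acc r then Dead else Expt, top : nat)
  | Push f r, 0 =>
      if r.+1 == P then (Push f 0, top.+1) else (Push f r.+1, top : nat)
  | Push f r, 1 => (Cmp f r 0, top : nat)
  | Cmp f r j, 0 =>
      if top then if j.+1 == c r then (Cmp f r 0, 0) else (Cmp f r (minn j.+1 B), 1)
      else (Cmp f r (minn j.+1 B), 0)
  | Cmp f r j, 1 => (if ~~ top && bad f r j then Acc else Dead, top : nat)
  | Expt, 1 => (End, top : nat)
  | Acc, 0 | Acc, 1 => (Acc, top : nat)
  | _, _ => (Dead, top : nat)
  end.

(** With a single stack symbol the stack is its height. On the empty stack, [0.-1 = 0] makes the
    same formula correct. *)
Definition cstep (cf : phase * nat) (x : nat) : phase * nat :=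
  let: (ph, k) := pstep cf.1 x (0 < cf.2) in (ph, cf.2.-1 + k).

Definition crun (cf : phase * nat) (w : seq nat) : phase * nat := foldl cstep cf w.

Arguments crun : simpl never.

Lemma crun_cons cf x w : crun cf (x :: w) = crun (cstep cf x) w.
Proof. by []. Qed.

Lemma crun_cat cf u v : crun cf (u ++ v) = crun (crun cf u) v.
Proof. exact: foldl_cat. Qed.

Lemma crun_dead t w : (crun (Dead, t) w).1 = Dead.
Proof. by elim: w t => //= x w IH t; rewrite crun_cons /cstep /= IH. Qed.

Lemma crun_acc w : all (gtn 2) w -> crun (Acc, 0) w = (Acc, 0).
Proof. by elim: w => //= -[|[|x]] w IH //= /IH; rewrite crun_cons. Qed.

Lemma crun_pre f r n : r < P ->
  crun (Pre f r, 0) (nseq n 0) = (Pre (f || (P <= r + n)) ((r + n) %% P), 0).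
Proof.
elim: n f r => [|n IH] f r rP /=.
  by rewrite addn0 modn_small // leqNgt rP orbF.
rewrite crun_cons /cstep /= IH ?ltn_pmod // modnDml addSnnS; congr (Pre _ _, 0).
case: eqP => [e|ne] /=.
  by rewrite orbT; symmetry; apply/orP; right; lia.
by rewrite orbF modn_small; [rewrite addSnnS|lia].
Qed.

Lemma crun_unmarked f r w : all (gtn 2) w ->
  exists f' r', crun (Pre f r, 0) w = (Pre f' r', 0).
Proof.
elim: w f r => [|x w IH] f r /=; first by exists f, r.
by case: x => [|[|x]] //= w2; rewrite crun_cons /cstep /=; exact: IH.
Qed.

Lemma crun_push f r t n : r < P ->
  crun (Push f r, t) (nseq n 0) = (Push f ((r + n) %% P), t + (r + n) %/ P).
Proof.
elim: n r t => [|n IH] r t rP /=.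
  by rewrite addn0 modn_small // divn_small // addn0.
rewrite crun_cons /cstep /=; case: eqP => [e|ne].
  rewrite IH // add0n -(addSnnS r) e modnDl divnDl // divnn P_gt0.
  by congr (_, _); case: t => [|t] /=; lia.
rewrite IH; last lia.
by rewrite addSnnS; congr (_, _); case: t => [|t] /=; lia.
Qed.

Lemma crun_cmp_pop f r t : r < P ->
  crun (Cmp f r 0, t) (nseq (c r * t) 0) = (Cmp f r 0, 0).
Proof.
move=> rP.
have pop1 k j s : j + k.+1 = c r ->
    crun (Cmp f r j, s.+1) (nseq k.+1 0) = (Cmp f r 0, s).
  elim: k j => [|k IH] j jk.
    by rewrite /= crun_cons /cstep /= -jk addn1 eqxx addn0.
  have -> : nseq k.+2 0 = 0 :: nseq k.+1 0 by [].
  rewrite crun_cons /cstep /=; case: eqP => [|_]; first lia.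
  (* As [c r <= B], the cap does not act while the stack is nonempty. *)
  rewrite addn1 (minn_idPl _); last by have := c_leB rP; lia.
  by apply: IH; lia.
elim: t => [|t IH]; first by rewrite muln0.
rewrite mulnS nseqD crun_cat.
have cr := c_gt0 rP.
by rewrite -{1}(prednK cr) pop1 ?IH // add0n prednK.
Qed.

Lemma crun_cmp_count f r j n : j <= B ->
  crun (Cmp f r j, 0) (nseq n 0) = (Cmp f r (minn (j + n) B), 0).
Proof.
elim: n j => [|n IH] j jB /=.
  by rewrite addn0 (minn_idPl jB).
rewrite crun_cons /cstep /= IH ?geq_minr //; congr (Cmp _ _ _, _); lia.
Qed.

Lemma crun_cmp f r t n : r < P -> c r * t <= n ->
  crun (Cmp f r 0, t) (nseq n 0) = (Cmp f r (minn (n - c r * t) B), 0).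
Proof.
move=> rP /subnKC {1}<-.
by rewrite nseqD crun_cat crun_cmp_pop // crun_cmp_count.
Qed.

Definition final_phase (ph : phase) : bool := (ph == Acc) || (ph == End).

Lemma crun_dead_final t w : ~~ final_phase (crun (Dead, t) w).1.
Proof. by rewrite crun_dead. Qed.

(** The cut lies either in the first block, possibly just before its closing letter, or after that
    block. *)
Lemma cat_blocks u v n ns : u ++ v = blocks (n :: ns) ->
  (exists p q, [/\ p + q = n, u = nseq p 0 & v = nseq q 0 ++ 1 :: blocks ns])
  \/ (exists2 u', u = nseq n 0 ++ 1 :: u' & u' ++ v = blocks ns).
Proof.
rewrite blocks_cons.
elim: n u => [|n IH] [|x u] /=.
- by move=> ->; left; exists 0, 0.
- by move=> [-> e]; right; exists u.
- by move=> ->; left; exists 0, n.+1.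
- move=> [-> /IH[[p [q [pq -> ->]]]|[u' -> e]]].
    by left; exists p.+1, q; split=> //; lia.
  by right; exists u'.
Qed.

Lemma crun_block n w :
  crun (Pre false 0, 0) (nseq n 0 ++ 1 :: w) = crun (Pre false 0, 0) w.
Proof. by rewrite crun_cat crun_pre // crun_cons. Qed.

Lemma blocks_unmarked ns : all (gtn 2) (blocks ns).
Proof.
by elim: ns => //= n ns IH; rewrite all_cat all_rcons all_nseq IH orbT.
Qed.

Lemma crun_end_cons t x w : ~~ final_phase (crun (End, t) (x :: w)).1.
Proof. by rewrite crun_cons /cstep /=; exact: crun_dead_final. Qed.

Lemma crun_unmarked_final f r w :
  all (gtn 2) w -> ~~ final_phase (crun (Pre f r, 0) w).1.
Proof. by case/(crun_unmarked f r) => f' [r' ->]. Qed.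

(** After a mark 2 at [p = i * P], the next block exceeds what the stack accounts for by
    [c r * i + d r]. This is [d r] if [i = 0] and at least [c r] otherwise, so [bad] fails; the
    bounds by [B] keep the cap from changing either comparison. After a mark 3, reaching [End]
    forces the block to be the last one, and there [acc] holds. *)
Lemma crun_mark_sound n p q x ns :
  p + q = n -> path (fun a b => b == col a) n ns -> acc (last n ns %% P) ->
  ~~ final_phase (crun (Pre (P <= p) (p %% P), 0)
                    (x :: nseq q 0 ++ 1 :: blocks ns)).1.
Proof.
move=> pq pn al; case: x => [|[|[|[|x]]]].
- by apply: crun_unmarked_final; rewrite /= all_cat all_nseq orbT /= blocks_unmarked.
- by apply: crun_unmarked_final; rewrite /= all_cat all_nseq orbT /= blocks_unmarked.
- rewrite crun_cons /cstep /=; case: eqP => [pP|_]; last exact: crun_dead_final.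
  have [i pE] : exists i, p = i * P by apply/dvdnP; apply/eqP.
  rewrite crun_cat crun_push // crun_cons /cstep /=.
  case: ns pn al => [|m ns] //= /andP[/eqP mE _] _.
  have nP : n %% P = q %% P by rewrite -pq pE modnMDl.
  have nD : n %/ P = i + q %/ P by rewrite -pq pE divnMDl.
  rewrite blocks_cons !add0n.
  have qP : q %% P < P by rewrite ltn_pmod.
  have -> : (q %/ P).-1 + (0 < q %/ P) = q %/ P.
    by case: (q %/ P) => //= k; rewrite addn1.
  have := c_gt0 qP; have := c_leB qP; have := d_ltB qP.
  rewrite /col nP nD mulnDr in mE.
  set cr := c _ in mE *; set dr := d _ in mE * => dB cB c0.
  rewrite crun_cat crun_cmp //; last by rewrite -/cr; lia.
  rewrite -/cr crun_cons /cstep /=.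
  suff -> : bad (P <= p) (q %% P) (minn (m - cr * (q %/ P)) B) = false.
    exact: crun_dead_final.
  rewrite /bad -/cr -/dr; move: (cr * (q %/ P)) mE => t mE.
  clear pP nP nD qP; clearbody cr dr; case: (leqP P p) => [Pp|pltP].
    have i0 : 0 < i 
      by rewrite lt0n; apply: contraTneq Pp => i0; rewrite pE i0 mul0n -ltnNge.
    have : cr * 1 <= cr * i by rewrite leq_mul2l i0 orbT.
    by lia.
  have i0 : i = 0.
    by move: pltP; rewrite pE -[X in _ < X]mul1n ltn_pmul2r // ltnS leqn0 => /eqP.
  by rewrite i0 in mE; apply/eqP; lia.
- rewrite crun_cons /cstep /=; case: ifP => [_|nacc]; first exact: crun_dead_final.
  case: q pq => [|q] pq; last by rewrite crun_cons /cstep /=; exact: crun_dead_final.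
  case: ns pn al => [|m ns] _ al; first by rewrite -pq addn0 /= nacc in al.
  rewrite crun_cons /cstep /= blocks_cons.
  by case: m {al} => [|m]; exact: crun_end_cons.
- by rewrite crun_cons /cstep /=; exact: crun_dead_final.
Qed.

Lemma checker_sound n ns u x v :
  path (fun a b => b == col a) n ns -> acc (last n ns %% P) ->
  u ++ v = blocks (n :: ns) ->
  ~~ final_phase (crun (Pre false 0, 0) (u ++ x :: v)).1.
Proof.
elim: ns n u => [|m ns IH] n u pn al /cat_blocks[[p [q [pq -> ->]]]|[u' -> e]].
- by rewrite crun_cat crun_pre //; exact: crun_mark_sound pq pn al.
(* The letter is appended to the whole word: a mark in that place stops in [Push], [Expt] or
   [Dead]. *)
- rewrite -catA /= crun_block; case: u' v e => [|? ?] [|? ?] //= _.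
  by case: x => [|[|[|[|x]]]] //; rewrite crun_cons /cstep /=; case: ifP.
- by rewrite crun_cat crun_pre //; exact: crun_mark_sound pq pn al.
- rewrite -catA /= crun_block; case/andP: pn => _ pn.
  exact: IH pn al e.
Qed.

(** The mark 2 goes to the block that starts the first wrong step. If all steps are right, the last
    block is not accepting and gets the mark 3 before its closing letter. *)
Lemma checker_complete n ns :
  ~~ (path (fun a b => b == col a) n ns && acc (last n ns %% P)) ->
  exists u x v, [/\ u ++ v = blocks (n :: ns), x < 4
    & crun (Pre false 0, 0) (u ++ x :: v) \in [:: (Acc, 0); (End, 0)]].
Proof.
elim: ns n => [|m ns IH] n /=.
  move=> nacc; exists (nseq n 0), 3, [:: 1]; split=> //.
    by rewrite blocks_cons.
  by rewrite crun_cat crun_pre //= crun_cons /cstep /= add0n (negPf nacc).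
have [mE /IH[u [x [v [e x4 r]]]]|mE _] := eqVneq m (col n).
  exists (nseq n 0 ++ 1 :: u), x, v; split=> //.
    by rewrite blocks_cons -e -catA.
  by rewrite -catA /= crun_block.
pose r := n %% P; pose t := n %/ P.
have nE : n = t * P + r by exact: divn_eq.
have rP : r < P by rewrite ltn_pmod.
have bw : blocks [:: n, m & ns] = nseq n 0 ++ 1 :: nseq m 0 ++ 1 :: blocks ns.
  by rewrite !blocks_cons.
have tail f s : bad f r (minn (m - c r * s) B) -> c r * s <= m ->
    crun (Push f 0, 0) (nseq (s * P + r) 0 ++ 1 :: nseq m 0 ++ 1 :: blocks ns)
    = (Acc, 0).
  move=> b cm; rewrite crun_cat crun_push // add0n modnMDl modn_small //.
  rewrite divnMDl // (divn_small rP) addn0 add0n crun_cons /cstep /=.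
  have -> : s.-1 + (0 < s) = s.
    by case: (s) => //= k; rewrite addn1.
  rewrite crun_cat crun_cmp // crun_cons /cstep /= b.
  exact: crun_acc (blocks_unmarked _).
have := c_gt0 rP; have := c_leB rP; have := d_ltB rP => dB cB c0.
have [cm|cm] := leqP (c r * t) m.
  exists [::], 2, (blocks [:: n, m & ns]); split=> //.
  rewrite /= crun_cons bw /cstep /= {1}nE tail ?inE //.
  (* Since [d r < B], an excess other than [d r] remains so after capping. *)
  rewrite /bad; move/eqP: mE; rewrite /col -/r -/t => mE; apply/eqP; lia.
(* The next block is too short for [t] symbols. Placing the mark so that only [s] are stacked leaves
   the excess [m %% c r], which is below [c r]. *)
pose s := m %/ c r.
have st : s < t by rewrite ltn_divLR // mulnC.
exists (nseq ((t - s) * P) 0), 2,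
  (nseq (s * P + r) 0 ++ 1 :: nseq m 0 ++ 1 :: blocks ns); split=> //.
  by rewrite bw catA -nseqD; congr (nseq _ 0 ++ _); rewrite nE; nia.
have sm : s * c r <= m by exact: leq_trunc_div.
rewrite crun_cat crun_pre // add0n modnMl leq_pmull ?subn_gt0 //=.
rewrite crun_cons /cstep /= tail ?inE //; last lia.
rewrite /bad; have := ltn_pmod m c0; have := divn_eq m (c r).
by rewrite -/s; lia.
Qed.

End Checker.

Arguments crun : simpl never.

(** * The automata *)

Section Simulation.

Variables (Sigma : finType) (A : pda Sigma) (X : Type).
Variables (emb : X -> config A) (inv : X -> Prop).
Variables (nxt : X -> Sigma -> option X) (x0 : X).
Hypothesis inv_x0 : inv x0.
Hypothesis inv_nxt : forall x s x', inv x -> nxt x s = Some x' -> inv x'.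
Hypothesis stepE : forall x s cf, inv x ->
  (step s (emb x) cf <-> exists2 x', nxt x s = Some x' & cf = emb x').
Hypothesis initialE : forall q, (q \in initial A) = (q == (emb x0).1).
Hypothesis stack_x0 : (emb x0).2 = [::].

Fixpoint orun (x : X) (w : seq Sigma) : option X :=
  if w is s :: w' then if nxt x s is Some x' then orun x' w' else None
  else Some x.

Lemma orun_run x w (cfs : nat -> config A) : inv x -> cfs 0 = emb x ->
  (forall i s, onth w i = Some s -> step s (cfs i) (cfs i.+1)) ->
  exists2 x', orun x w = Some x' & cfs (size w) = emb x'.
Proof.
elim: w x cfs => [|s w IH] x cfs ix c0 st /=; first by exists x.
have := st 0 s erefl; rewrite c0 => /(stepE _ _ ix)[x' nx c1].
rewrite nx; apply: (IH x' (fun i => cfs i.+1)) => //; first exact: inv_nxt nx.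
by move=> i s' ws; exact: (st i.+1).
Qed.

Lemma run_orun x w x' : inv x -> orun x w = Some x' ->
  exists cfs : nat -> config A, [/\ cfs 0 = emb x, cfs (size w) = emb x'
    & forall i s, onth w i = Some s -> step s (cfs i) (cfs i.+1)].
Proof.
elim: w x => [|s w IH] x ix /=; first by case=> <-; exists (fun=> emb x); split=> // -[].
case nx: (nxt x s) => [y|] // /(IH _ (inv_nxt ix nx))[cfs [c0 cw st]].
exists (fun i => if i is j.+1 then cfs j else emb x); split=> //.
move=> [|i] s' /=; last exact: st.
by case=> <-; rewrite c0; apply/(stepE _ _ ix); exists y.
Qed.

(** Replaces the existence of an accepting run by the evaluation of [orun]. The invariant restricts
    [stepE] to configurations that really encode an abstract state. *)
Lemma language_orun w : language A w <->
  exists2 x, orun x0 w = Some x & (emb x).1 \in final A /\ (emb x).2 = [::].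
Proof.
split=> [[cfs [[i0 s0 st] fw sw]]|[x rw [fx sx]]].
  have c0 : cfs 0 = emb x0.
    move: i0 s0; rewrite initialE; case: (cfs 0) => q u /= /eqP-> ->.
    by rewrite -stack_x0 -surjective_pairing.
  have [x rx ex] := orun_run inv_x0 c0 st.
  by exists x => //; rewrite -ex.
have [cfs [c0 cw st]] := run_orun inv_x0 rw.
exists cfs; split; rewrite ?cw //; split=> //; rewrite c0 ?stack_x0 //.
by rewrite initialE.
Qed.

End Simulation.

Lemma rank_ord n (i : 'I_n) : rank i = i.
Proof. by rewrite /rank enum_rank_ord. Qed.

Lemma val_inord n i : i < n.+1 -> val (inord i : 'I_n.+1) = i.
Proof. exact: inordK. Qed.

(** * The DFA of histories with a given first block *)

Section Histories.

Variable X : nat.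

(* States 0 to 3 hold the parity of the number of letters read after the first
   block (bit 0) and whether the last letter was 0 (bit 1); states [X + 4] down
   to 4 read the first block. *)
Fixpoint hist_trans (X : nat) : seq (nat * nat * nat) :=
  if X is i.+1 then (i.+4.+1, 0, i.+4) :: hist_trans i
  else [:: (0, 0, 3); (0, 1, 1); (1, 0, 2); (1, 1, 0); (2, 0, 3); (2, 1, 1);
           (3, 0, 2); (3, 1, 0); (4, 1, 0)].

Definition hist_next (q s : nat) : option nat :=
  match q, s with
  | 0, 0 | 2, 0 => Some 3 | 0, 1 | 2, 1 => Some 1
  | 1, 0 | 3, 0 => Some 2 | 1, 1 | 3, 1 | 4, 1 => Some 0
  | i.+4.+1, 0 => Some i.+4
  | _, _ => None
  end.

Lemma hist_transE q s q' :
  ((q, s, q') \in hist_trans X) = (q < X + 5) && (hist_next q s == Some q').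
Proof.
elim: X => [|i IH].
  rewrite /= !inE; case: q => [|[|[|[|[|q]]]]]; case: s => [|[|s]] //=;
    rewrite !xpair_eqE /= ?orbF; exact: eq_sym.
rewrite /= inE IH; apply/orP/idP.
- case=> [/eqP[-> -> ->]|/andP[qi ->]]; first by rewrite /= eqxx andbT; lia.
  by rewrite andbT; lia.
- case/andP=> qi nq; have [qi'|qi'] := ltnP q (i + 5); first by right; rewrite nq.
  left; have qE : q = i.+4.+1 by lia.
  by move: nq; rewrite qE; case: s {IH} => //= /eqP[->].
Qed.

Definition hist_pda : pda 'I_4 :=
  @Pda 'I_4 'I_0 'I_(X + 4).+1 [set inord (X + 4)]
    [seq (inord t.1.1, inord t.1.2, None, inord t.2, [::]) | t <- hist_trans X]
    [set inord 0].

Lemma hist_trans_lt q s q' : (q, s, q') \in hist_trans X ->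
  [/\ q < (X + 4).+1, s < 4 & q' < (X + 4).+1].
Proof.
rewrite hist_transE => /andP[qX]; rewrite /hist_next.
by case: q qX => [|[|[|[|[|q]]]]] qX; case: s => [|[|s]] // /eqP[<-]; split; lia.
Qed.

Lemma hist_pda_transE (q q' : 'I_(X + 4).+1) (s : 'I_4) a u :
  (q, s, a, q', u) \in trans hist_pda ->
  [/\ hist_next q s = Some (q' : nat), a = None & u = [::]].
Proof.
case/mapP=> -[[q1 s1] q1'] tin [-> -> -> -> ->]; split=> //.
have [q1X s1X q1'X] := hist_trans_lt tin.
by rewrite !inordK //; move: tin; rewrite hist_transE => /andP[_ /eqP].
Qed.

Lemma hist_pda_dfa : empty_stack_alphabet hist_pda /\ deterministic hist_pda.
Proof.
split; first by rewrite /empty_stack_alphabet card_ord.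
split; first by rewrite cards1.
move=> q s a q1 u1 q2 u2 /hist_pda_transE[e1 _ ->] /hist_pda_transE[e2 _ ->].
by congr (_, _); apply: val_inj; apply: Some_inj; rewrite -e1.
Qed.

Fixpoint hist_run (q : nat) (w : seq nat) : option nat :=
  if w is s :: w' then if hist_next q s is Some q' then hist_run q' w' else None
  else Some q.

Lemma hist_next_lt q s q' : q < (X + 4).+1 -> hist_next q s = Some q' ->
  s < 4 /\ q' < (X + 4).+1.
Proof.
move=> qX nq; suff : (q, s, q') \in hist_trans X by case/hist_trans_lt.
by rewrite hist_transE nq eqxx andbT; lia.
Qed.

Lemma hist_pda_run w : language hist_pda w <->
  hist_run (X + 4) [seq val s | s <- w] = Some 0.
Proof.
pose nxt (q : 'I_(X + 4).+1) (s : 'I_4) : option 'I_(X + 4).+1 :=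
  omap inord (hist_next q s).
have nxtE q s q' : nxt q s = Some q' <-> hist_next q s = Some (val q').
  rewrite /nxt; split=> [|->]; last by rewrite /= inord_val.
  case nq: hist_next => [m|] //= [<-]; rewrite inordK //.
  by case: (hist_next_lt (ltn_ord q) nq).
have runE q q' : orun nxt q w = Some q' <->
    hist_run q [seq val s | s <- w] = Some (val q').
  elim: w q => [|s w IH] q /=.
    by split=> [[->]|[e]] //; congr Some; apply: val_inj.
  case nq: (nxt q s) => [q1|]; first by rewrite (proj1 (nxtE _ _ _) nq); exact: IH.
  by move: nq; rewrite /nxt; case: hist_next.
have stE q s cf : True -> (@step _ hist_pda s (q, [::]) cf <->
    exists2 q', nxt q s = Some q' & cf = (q', [::])).
  move=> _; split=> [[|[? [u [? [? [? [[_ e] _]]]]]]]|[q' nq ->]].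
  - case=> [q1 [q' [u [[<-] -> /hist_pda_transE[nq _ ->]]]]].
    by exists q' => //; apply/nxtE.
  - by case: u e.
  - left; exists q, q', [::]; split=> //.
    move/nxtE: nq => nq; apply/mapP; exists (val q, val s, val q').
      by rewrite hist_transE nq eqxx andbT; apply: leq_trans (ltn_ord q) _; lia.
    by rewrite !inord_val.
have iE q : (q \in initial hist_pda) = (q == inord (X + 4)) by rewrite inE.
apply: (iff_trans (@language_orun _ hist_pda _ (fun q => (q, [::])) (fun=> True)
  nxt (inord (X + 4)) I (fun _ _ _ _ _ => I) stE iE erefl w)); split.
  case=> q /runE; rewrite inordK // => -> [].
  by rewrite /= inE => /eqP-> _; rewrite /= inordK.
move=> rw; exists (inord 0); last by rewrite inE eqxx.
by apply/runE; rewrite inordK // val_inord.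
Qed.

Lemma hist_run_first v :
  hist_run X.+4 v = Some 0 <->
  exists2 v', v = nseq X 0 ++ 1 :: v' & hist_run 0 v' = Some 0.
Proof.
elim: X v => [|i IH] v.
  split=> [|[v' -> rv]] //.
  by case: v => [|[|[|s]] v] //= rv; exists v.
split=> [|[v' -> rv] /=].
  case: v => [|[|s] v] //= /(proj1 (IH _))[v' -> rv]; by exists v'.
by apply/IH; exists v'.
Qed.

(** The state [p + k.*2] packs the parity and whether the last letter was 0. For empty [v], the
    default [~~ k] of [last] is a letter that agrees with [k]. *)
Lemma hist_run_tail (p k : bool) v :
  hist_run (p + k.*2) v = if all (gtn 2) v
    then Some ((p (+) odd (size v)) + (last (~~ k : nat) v == 0).*2) else None.
Proof.
elim: v p k => [|s v IH] p k /=; first by rewrite addbF; case: k.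
have -> : hist_next (p + k.*2) s =
    if s < 2 then Some (~~ p + (s == 0).*2) else None.
  by case: p; case: k; case: s => [|[|s]].
case: s => [|[|s]] //=.
  by have /= -> := IH (~~ p) true; rewrite addNb -addbN.
by have /= -> := IH (~~ p) false; rewrite addNb -addbN.
Qed.

Lemma blocksP v : (exists ns, v = blocks ns) <-> all (gtn 2) v && (last 1 v == 1).
Proof.
split=> [[ns ->]|].
  elim/last_ind: ns => // ns n _.
  by rewrite blocks_unmarked /blocks map_rcons flatten_rcons last_cat last_rcons.
elim: v => [|s v IH] /=; first by exists [::].
case: s => [|[|s]] //= /andP[v2 lv].
  have v0 : v != [::] by apply: contraTneq lv => ->.
  have [|ns vE] := IH; first by rewrite v2; case: v v0 lv {IH v2}.
  case: ns vE => [|n ns] vE; first by rewrite vE in v0.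
  by exists (n.+1 :: ns); rewrite vE !blocks_cons.
have [|ns vE] := IH; first by rewrite v2.
by exists (0 :: ns); rewrite blocks_cons vE.
Qed.

Theorem hist_pda_language w : language hist_pda w <->
  exists2 ns, [seq val s | s <- w] = blocks (X :: ns) & ~~ odd (size (blocks ns)).
Proof.
rewrite hist_pda_run addn4 hist_run_first; split=> [[v ->]|[ns -> pns]].
  rewrite (hist_run_tail false false) /=; case: ifP => // v2 [].
  case pv: (odd _) => //=; case lv: (_ == 0) => // _.
  have [|ns vE] := proj2 (blocksP v).
    rewrite v2 /=; have : last 1 v \in [:: 0; 1].
      have : last 1 v \in 1 :: v by exact: mem_last.
      rewrite inE => /predU1P[->//|/(allP v2)]; by case: last => [|[|]].
    by rewrite !inE lv.
  by exists ns; rewrite ?blocks_cons -vE ?pv.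
exists (blocks ns); first by rewrite blocks_cons.
have /andP[v2 /eqP lv] : all (gtn 2) (blocks ns) && (last 1 (blocks ns) == 1).
  by apply/blocksP; exists ns.
by rewrite (hist_run_tail false false) v2 /= (negPf pns) lv.
Qed.
End Histories.

(** * The checker as a DPDA with one stack symbol *)

Section CheckerPda.

Variables (P B : nat) (c d : nat -> nat) (acc : pred nat) (N : nat).
Hypothesis P_gt0 : 0 < P.

Notation pstep := (pstep P B c d acc).
Notation cstep := (cstep P B c d acc).
Notation crun := (crun P B c d acc).

Definition phases : seq phase :=
  let fr := [seq (f, r) | f <- [:: false; true], r <- iota 0 P] in
  [:: Expt; Acc; End; Dead] ++ [seq Pre x.1 x.2 | x <- fr]
  ++ [seq Push x.1 x.2 | x <- fr]
  ++ [seq Cmp x.1 x.2 j | x <- fr, j <- iota 0 B.+1].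

(* The boolean is the parity of the number of letters read. *)
Definition states : seq (bool * phase) :=
  [:: (false, Acc); (false, End); (false, Pre false 0)]
  ++ [seq (p, ph) | p <- [:: false; true], ph <- phases].

Definition phase_ok (ph : phase) : bool :=
  match ph with
  | Pre _ r | Push _ r => r < P
  | Cmp _ r j => (r < P) && (j <= B)
  | _ => true
  end.

Lemma mem_states p ph : phase_ok ph -> (p, ph) \in states.
Proof.
move=> ok; rewrite /states mem_cat; apply/orP; right.
apply/allpairsP; exists (p, ph); split=> //; first by case: p.
have frP f r : r < P -> (f, r) \in [seq (f, r) | f <- [:: false; true], r <- iota 0 P].
  move=> rP; apply/allpairsP; exists (f, r); split=> //; first by case: f.
  by rewrite mem_iota.
rewrite /= /phases !mem_cat; case: ph ok => //.
- by move=> f r /(frP f) h; apply/or4P/Or42/mapP; exists (f, r).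
- by move=> f r /(frP f) h; apply/or4P/Or43/mapP; exists (f, r).
- move=> f r j /andP[/(frP f) h jB]; apply/or4P/Or44/allpairsP.
  by exists ((f, r), j); split=> //; rewrite mem_iota.
Qed.

Lemma phase_ok_states q : q \in states -> phase_ok q.2.
Proof.
have frP x : x \in [seq (f, r) | f <- [:: false; true], r <- iota 0 P] -> x.2 < P.
  by case/allpairsP=> -[f r] [_ /=]; rewrite mem_iota => rP ->.
rewrite /states mem_cat => /orP[|/allpairsP].
  by rewrite !inE => /or3P[]/eqP->.
case=> -[p ph] [_ /= phin ->] /=; move: phin.
rewrite /phases !mem_cat => /or4P[|/mapP|/mapP|/allpairsP].
- by rewrite !inE => /or4P[]/eqP->.
- by case=> x /frP xP ->.
- by case=> x /frP xP ->.
- by case=> -[x j] [/frP xP jB ->] /=; move: jB; rewrite mem_iota xP.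
Qed.

Lemma pstep_ok ph x top : phase_ok ph -> phase_ok (pstep ph x top).1.
Proof.
case: ph => [f r|f r|f r j||||]; case: x => [|[|[|[|x]]]] //= ok.
- by rewrite ltn_pmod.
- by case: ifP.
- by case: ifP.
- by case: eqP => //= ?; lia.
- by rewrite ok.
- case/andP: ok => rP jB; case: top; last by rewrite /= rP geq_minr.
  by case: ifP => _ /=; rewrite rP // geq_minr.
- by case: ifP.
Qed.

Lemma crun_ok ph t w : phase_ok ph -> phase_ok (crun (ph, t) w).1.
Proof.
elim: w ph t => //= x w IH ph t ok; rewrite crun_cons /cstep /=.
by have := pstep_ok x (0 < t) ok; case: (pstep _ _ _) => ph' k /=; exact: IH.
Qed.

(** The three states heading the list get fixed numbers, 0 and 1 for the final states and 2 for the
    initial one, whatever [P] and [B] are; [index] ignores their later second occurrence. *)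
Definition num (q : bool * phase) : nat := index q states.

Definition keys : seq (bool * phase * nat * bool) :=
  [seq (y, top) | y <- [seq (q, x) | q <- states, x <- iota 0 4],
                  top <- [:: false; true]].

Definition key_next (z : bool * phase * nat * bool) : (bool * phase) * nat :=
  let: (q, x, top) := z in
  ((~~ q.1, (pstep q.2 x top).1), (pstep q.2 x top).2).

Definition key_trans (z : bool * phase * nat * bool) :
    'I_N.+1 * 'I_4 * option 'I_1 * 'I_N.+1 * seq 'I_1 :=
  (inord (num z.1.1), inord z.1.2, if z.2 then Some ord0 else None,
   inord (num (key_next z).1), nseq (key_next z).2 ord0).

(** The number [N.+1] of states is left free so that it can later equal the code of the transitions;
    states beyond those of [states] have no transitions. *)
Definition checker_pda : pda 'I_4 :=
  @Pda 'I_4 'I_1 'I_N.+1 [set inord 2] [seq key_trans z | z <- keys]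
    [set inord 0; inord 1].

Hypothesis N_states : size states <= N.+1.

Lemma mem_keys q x top :
  ((q, x, top) \in keys) = (q \in states) && (x < 4).
Proof.
apply/allpairsP/andP => [[[[q' x'] top'] [qx _ [-> -> _]]]|[qs x4]].
  by move/allpairsP: qx => [[q1 x1] [qs]]; rewrite mem_iota => x4 [-> ->].
exists ((q, x), top); split=> //; last by case: top.
by apply/allpairsP; exists (q, x); split=> //; rewrite mem_iota.
Qed.

Lemma num_lt q : q \in states -> num q < N.+1.
Proof. by move=> qs; apply: leq_trans N_states; rewrite index_mem. Qed.

Lemma inord_num_inj q q' : q \in states -> q' \in states ->
  inord (num q) = inord (num q') :> 'I_N.+1 -> q = q'.
Proof.
move=> qs qs' /(congr1 val); rewrite /= !inordK ?num_lt // => e.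
by rewrite -(nth_index (false, Acc) qs) -(nth_index (false, Acc) qs') -/(num q) e.
Qed.

Lemma checker_transE q (s : 'I_4) a q' u : q \in states ->
  ((inord (num q), s, a, q', u) \in trans checker_pda) <->
  let z := key_next (q, val s, a : bool) in
  q' = inord (num z.1) /\ u = nseq z.2 ord0.
Proof.
move=> qs; split.
  case/mapP=> -[[q0 x] top] kin [qE -> -> -> ->].
  rewrite mem_keys in kin; case/andP: kin => q0s x4.
  have -> := inord_num_inj qs q0s qE.
  by rewrite (val_inord x4); case: top; split.
case=> -> ->; apply/mapP; exists (q, val s, a : bool); first by rewrite mem_keys qs ltn_ord.
by rewrite /key_trans /= inord_val; case: a => // i; rewrite (ord1 i).
Qed.

Lemma checker_dpda : deterministic checker_pda.
Proof.
split; first by rewrite cards1.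
move=> q s a q1 u1 q2 u2 t1 t2.
have [q0 q0s qE] : exists2 q0, q0 \in states & q = inord (num q0).
  move/mapP: t1 => [[[q0 x] top]]; rewrite mem_keys => /andP[q0s _] [-> _ _ _ _].
  by exists q0.
rewrite qE in t1 t2.
have [-> ->] := proj1 (checker_transE _ _ _ _ q0s) t1.
by have [-> ->] := proj1 (checker_transE _ _ _ _ q0s) t2.
Qed.

Definition pda_next (y : bool * phase * nat) (s : 'I_4) :=
  let z := key_next (y.1, val s, 0 < y.2) in Some (z.1, y.2.-1 + z.2).

Definition pda_config (y : bool * phase * nat) : config checker_pda :=
  (inord (num y.1), nseq y.2 ord0).

Lemma rcons_ord1 (u : seq 'I_1) a : rcons u a = nseq (size u).+1 ord0.
Proof. by elim: u => [|b u IH] /=; rewrite ?IH ?(ord1 a) ?(ord1 b). Qed.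

Lemma checker_stepE y s cf : y.1 \in states ->
  step s (pda_config y) cf <->
  exists2 y', pda_next y s = Some y' & cf = pda_config y'.
Proof.
case: y => q t /= qs; split.
  case=> [[q0 [q' [u [[<- t0] -> tin]]]]|].
    have [-> ->] := proj1 (checker_transE _ _ _ _ qs) tin.
    by case: t t0 => // _; eexists.
  case=> q0 [u [a [q' [u' [[<- tE] -> tin]]]]].
  have [-> ->] := proj1 (checker_transE _ _ _ _ qs) tin.
  have -> : t = (size u).+1.
    by have := congr1 size tE; rewrite size_nseq size_rcons.
  eexists; first by [].
  rewrite /pda_config /= nseqD; congr (_, _ ++ _).
  by elim: u {tE tin} => //= b u <-; rewrite (ord1 b).
case=> y' [<-] ->; case: t => [|t].
  left; exists (inord (num q)); do 2 eexists; split=> //.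
  exact/checker_transE.
right; exists (inord (num q)), (nseq t ord0), ord0; do 2 eexists; split.
- by rewrite rcons_ord1 size_nseq.
- by rewrite /pda_config /= nseqD.
- exact/checker_transE.
Qed.

Lemma pda_run p ph t w : orun pda_next ((p, ph), t) w =
  Some ((p (+) odd (size w), (crun (ph, t) [seq val s | s <- w]).1),
        (crun (ph, t) [seq val s | s <- w]).2).
Proof.
elim: w p ph t => [|s w IH] p ph t /=; first by rewrite addbF.
rewrite IH crun_cons /cstep /=; case: (pstep _ _ _) => ph' k /=.
by rewrite addNb addbN.
Qed.

Theorem checker_language w : language checker_pda w <->
  ~~ odd (size w) /\
  crun (Pre false 0, 0) [seq val s | s <- w] \in [:: (Acc, 0); (End, 0)].
Proof.
have inv0 : (false, Pre false 0) \in states by [].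
have invS y s y' : y.1 \in states -> pda_next y s = Some y' -> y'.1 \in states.
  case: y => -[p ph] t /= /phase_ok_states ok [<-] /=.
  by apply: mem_states; exact: pstep_ok.
apply: (iff_trans (@language_orun _ checker_pda _ pda_config
  (fun y => y.1 \in states) pda_next ((false, Pre false 0), 0) inv0 invS
  checker_stepE _ erefl w)); first by move=> q; rewrite inE.
rewrite pda_run /=.
have ok : phase_ok (crun (Pre false 0, 0) [seq val s | s <- w]).1.
  by apply: crun_ok.
case: (crun _ _) ok => ph t /= ok.
have qs := mem_states (odd (size w)) ok.
have finE : (inord (num (odd (size w), ph)) \in final checker_pda) =
    ((odd (size w), ph) \in [:: (false, Acc); (false, End)]).
  rewrite !inE -[inord 0]/(inord (num (false, Acc))) -[inord 1]/(inord (num (false, End))).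
  have inj q' : q' \in states ->
      (inord (num (odd (size w), ph)) == inord (num q') :> 'I_N.+1)
      = ((odd (size w), ph) == q').
    by move=> qs'; apply/eqP/eqP => [|->//]; exact: inord_num_inj.
  by rewrite !inj.
split.
  case=> _ [<-] /= []; rewrite finE !inE.
  by case: t => // /orP[]/eqP[-> ->].
case=> /negPf pw phin; rewrite pw in finE *.
exists (false, ph, t) => //; rewrite /= finE.
by move: phin; rewrite !inE => /orP[]/eqP[-> ->].
Qed.

End CheckerPda.

(** * The reduction *)

(** Distances are integers: if no [w2] is within [k], all distances are at least [k.+1], and so is
    their infimum. *)
Lemma lang_ed_le (R : realType) (Sigma : finType) (L1 L2 : set (seq Sigma)) k :
  (lang_ed R L1 L2 <= (k%:R : R)%R%:E)%E <->
  forall w1, L1 w1 -> exists2 w2, L2 w2 & ed w1 w2 <= k.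
Proof.
rewrite /lang_ed; split=> [le_k w1 L1w1|H].
  apply: contrapT => none.
  suff: (((k.+1)%:R : R)%R%:E <= (k%:R : R)%R%:E)%E.
    by rewrite lee_fin ler_nat ltnn.
  apply: le_trans le_k; apply: le_ereal_sup_tmp.
  eexists; first by exists w1.
  apply: le_ereal_inf_tmp => _ [w2 L2w2 <-]; rewrite lee_fin ler_nat ltnNge.
  by apply/negP => edk; apply: none; exists w2.
apply: ge_ereal_sup => _ [w1 /H[w2 L2w2 edk] <-].
by apply: ge_ereal_inf; exists (((ed w1 w2)%:R : R)%R%:E);
  [exists w2 | rewrite lee_fin ler_nat].
Qed.

Lemma ed_le1 (Sigma : finType) (w1 w2 : seq Sigma) :
  ed w1 w2 <= 1 <-> w1 = w2 \/ edit w1 w2.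
Proof.
rewrite /ed; case: ex_minnP => n /asboolP en minn; split.
  case: n en {minn} => [|[|n]] //= en _; first by left.
  by case: en => w e <-; right.
case=> e; last by apply: minn; apply/asboolP; exists w2.
by apply: leq_trans (minn 0 _) _ => //; apply/asboolP.
Qed.

Section Reduction.

Variables (X P B N : nat) (c d : nat -> nat) (acc : pred nat).
Hypothesis X_even : ~~ odd X.
Hypothesis P_gt0 : 0 < P.
Hypothesis c_gt0 : forall r, r < P -> 0 < c r.
Hypothesis c_leB : forall r, r < P -> c r <= B.
Hypothesis d_ltB : forall r, r < P -> d r < B.
Hypothesis N_states : size (states P B) <= N.+1.

Let word (s : seq nat) : seq 'I_4 := [seq inord x | x <- s].

Let val_word s : all (gtn 4) s -> [seq val x | x <- word s] = s.
Proof.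
move=> /allP s4; rewrite -map_comp -[RHS]map_id; apply/eq_in_map => x /s4.
by move=> x4; rewrite /= inordK.
Qed.

Let word_val (w : seq 'I_4) : word [seq val x | x <- w] = w.
Proof.
by rewrite /word -map_comp -[RHS]map_id; apply: eq_map => x; rewrite /= inord_val.
Qed.

(** Words of the DFA have odd length and words of the DPDA even length, which excludes equality and
    substitution. A deletion leaves no mark, and an insertion into a correct accepting history fails
    by [checker_sound]. For every other history [checker_complete] supplies the letter to insert. *)
Theorem ted_histories (R : realType) :
  (lang_ed R (language (hist_pda X)) (language (checker_pda P B c d acc N))
     <= (1%:R : R)%R%:E)%E <->
  ~ exists ns, [/\ path (fun a b => b == col P c d a) X ns,
                   acc (last X ns %% P) & ~~ odd (size (blocks ns))].
Proof.
have unm ns : all (gtn 4) (blocks ns).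
  by apply: sub_all (blocks_unmarked ns) => x /=; lia.
have size_hist ns : ~~ odd (size (blocks ns)) -> odd (size (blocks (X :: ns))).
  by rewrite blocks_cons size_cat size_nseq /= addnS /= oddD (negPf X_even).
rewrite lang_ed_le; split=> [H [ns [pns ans ons]]|H w1 /hist_pda_language[ns w1E ons]].
  have [|w2] := H (word (blocks (X :: ns))).
    by apply/hist_pda_language; exists ns; rewrite // val_word.
  move=> /(checker_language c d acc P_gt0 N_states)[ow2 rw2] /ed_le1.
  have sw : odd (size (word (blocks (X :: ns)))) by rewrite size_map size_hist.
  have fin2 : final_phase (crun P B c d acc (Pre false 0, 0) [seq val s | s <- w2]).1.
    by move: rw2; rewrite !inE => /orP[]/eqP->.
  case=> [eq_w|ed_w]; first by rewrite -eq_w sw in ow2.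
  move eW: (word (blocks (X :: ns))) ed_w sw => W ed_w.
  case: ed_w eW ow2 fin2 {rw2}.
  - move=> u v a e _ + _; apply/negP.
    rewrite map_cat /=; apply: checker_sound pns ans _ => //.
    by rewrite -map_cat -e val_word.
  - move=> u v a e _ + _; apply/negP; apply: crun_unmarked_final.
    have : all (gtn 2) [seq val s | s <- u ++ a :: v].
      by rewrite -e val_word ?blocks_unmarked.
    by rewrite !map_cat !all_cat /= => /and3P[-> _ ->].
  - by move=> u v a b _ ow _; rewrite size_cat /= => sw; move: ow; rewrite size_cat /= sw.
have : ~~ (path (fun a b => b == col P c d a) X ns && acc (last X ns %% P)).
  by apply/negP => /andP[pns ans]; apply: H; exists ns.
case/(checker_complete (B := B) P_gt0 c_gt0 c_leB d_ltB) => u [x [v [e x4 rw]]].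
have uv4 : all (gtn 4) (u ++ x :: v).
  by have := unm (X :: ns); rewrite -e !all_cat /= x4.
exists (word (u ++ x :: v)).
  apply/(checker_language c d acc P_gt0 N_states); rewrite val_word //; split=> //.
  rewrite size_map size_cat /= addnS /= -size_cat e negbK; exact: size_hist.
apply/ed_le1; right; rewrite -[w1]word_val w1E -e /word !map_cat /=.
exact: edit_ins.
Qed.

End Reduction.

(** * Undecidability *)

Lemma fmatch_dvd L n : (fmatch L n).1 %| n.
Proof. by elim: L => //= ru L IH; case: ifP. Qed.

Lemma fmatch_in L n : fmatch L n \in (1, 1) :: L.
Proof.
elim: L => //= ru L; rewrite !inE => IH; case: ifP => _; first by rewrite eqxx orbT.
by case/orP: IH => ->; rewrite ?orbT.
Qed.

Lemma fmatch_mod L P n : (forall ru, ru \in L -> ru.1 %| P) ->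
  fmatch L (n %% P) = fmatch L n.
Proof.
elim: L => //= ru L IH dP.
have ruP : ru.1 %| P by apply: dP; rewrite inE eqxx.
have -> : (ru.1 %| n %% P) = (ru.1 %| n).
  by rewrite {2}(divn_eq n P) dvdn_addr // dvdn_mull.
by case: ifP => // _; apply: IH => ru' ru'L; apply: dP; rewrite inE ru'L orbT.
Qed.

(** * Fractran steps as maps that are affine on residue classes *)

Section FractranTable.

Variables (L : seq (nat * nat)) (D : nat).
Hypothesis L_gt0 : all (fun ru => (0 < ru.1) && (0 < ru.2)) L.
Hypothesis D_gt0 : 0 < D.

(** A common multiple of [D] and all denominators: the residue determines the rule that fires and
    whether [D] divides. *)
Definition fmod : nat := D * \prod_(ru <- L) ru.1.
Definition fcoef (r : nat) : nat := fmod %/ (fmatch L r).1 * (fmatch L r).2.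
Definition fbound : nat := \max_(r < fmod) (fcoef r + fstep L r).+1.

Lemma fmod_gt0 : 0 < fmod.
Proof.
rewrite muln_gt0 D_gt0 big_seq prodn_cond_gt0 // => ru ruL.
by case/andP: (allP L_gt0 _ ruL).
Qed.

Lemma fmod_dvd ru : ru \in (1, 1) :: L -> ru.1 %| fmod.
Proof.
by rewrite inE => /predU1P[->|ruL]; rewrite ?dvd1n // /fmod (big_rem ru) //= dvdn_mull ?dvdn_mulr.
Qed.

Lemma fmatch_gt0 n : (0 < (fmatch L n).1) && (0 < (fmatch L n).2).
Proof.
by have := fmatch_in L n; rewrite inE => /predU1P[->|/(allP L_gt0)].
Qed.

Lemma fcoef_gt0 r : r < fmod -> 0 < fcoef r.
Proof.
move=> _; case/andP: (fmatch_gt0 r) => d0 n0.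
rewrite muln_gt0 n0 andbT divn_gt0 // dvdn_leq ?fmod_gt0 //.
exact: fmod_dvd (fmatch_in _ _).
Qed.

Lemma fbound_ge r : r < fmod -> (fcoef r + fstep L r).+1 <= fbound.
Proof. by move=> rP; exact: (leq_bigmax (Ordinal rP)). Qed.

(** The denominator of the firing rule divides [fmod], so the step distributes over quotient and
    residue, and the offset at the residue [r] is [fstep L r] itself. *)
Lemma col_fstep n : col fmod fcoef (fstep L) n = fstep L n.
Proof.
have dP : (fmatch L n).1 %| fmod by exact: fmod_dvd (fmatch_in _ _).
rewrite /col /fcoef /fstep !fmatch_mod; try by
  move=> ru ruL; apply: fmod_dvd; rewrite inE ruL orbT.
set de := (fmatch L n).1 in dP *; set nu := (fmatch L n).2.
rewrite [in RHS](divn_eq n fmod) (divnDl _ (dvdn_mull _ dP)) mulnDl -muln_divA //.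
by rewrite mulnAC (mulnC (_ %/ de)).
Qed.

End FractranTable.

(** An applicable rule tests the label of [n], and then acts as [rep_goto], [rep_inc] or [rep_dec].
    No execution of [p] is assumed, so this covers the whole orbit of a code. *)
Lemma rules_rep p s0 e0 ru n s st :
  ru \in rules p s0 e0 -> rep n s st -> ru.1 %| n ->
  exists s' st', rep (n %/ ru.1 * ru.2) s' st'.
Proof.
have lab a : rep n s st -> labp a %| n -> a = s.
  by move=> repn; rewrite (rep_labp a repn) => /eqP.
have dec a r b : rep n s st -> labp a * regp r %| n ->
    exists s' st', rep (n %/ (labp a * regp r) * labp b) s' st'.
  move=> repn dn; have as_ := lab a repn (dvdn_trans (dvdn_mulr _ (dvdnn _)) dn).
  move: dn; rewrite as_ (rep_regp r repn) => str.
  by exists b, (upd st r (st r).-1); apply: rep_dec; rewrite ?prednK.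
have goto a b : rep n s st -> labp a %| n ->
    exists s' st', rep (n %/ labp a * labp b) s' st'.
  by move=> repn /(lab a repn)->; exists b, st; exact: rep_goto.
elim: p s0 e0 => [r|r|p IHp q IHq|r p IHp] s0 e0 /=.
- rewrite inE => /eqP-> repn /= /(lab _ repn)->.
  by exists e0, (upd st r (st r).+1); exact: rep_inc.
- by rewrite !inE => /orP[]/eqP->; [exact: dec | exact: goto].
- by rewrite mem_cat => /orP[]; [exact: IHp | exact: IHq].
- rewrite !inE => /or3P[/eqP->|/eqP->|]; [exact: dec | exact: goto | exact: IHp].
Qed.

Lemma iter_fstep_rep p e n s st k : rep n s st ->
  exists s' st', rep (iter k (fstep (rules p 0 e)) n) s' st'.
Proof.
move=> repn; elim: k => [|k [s1 [st1 rep1]]]; first by exists s, st.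
rewrite iterS /fstep; set m := iter _ _ _ in rep1 *.
have := fmatch_in (rules p 0 e) m; rewrite inE => /predU1P[->|ruL].
  by exists s1, st1; rewrite divn1 muln1.
exact: rules_rep ruL rep1 (fmatch_dvd _ _).
Qed.

(** * Accepting histories and the output of a terminating program *)

Section Halting.

Variables (p : prog) (n : nat).
Hypothesis n_gt0 : 0 < n.

Let e := prog_size p.
Let L := rules p 0 e.

(** Since [regp 0] is 2, this codes the entry label with [n] in register 0 and all other registers
    empty. *)
Definition start : nat := labp 0 * 2 ^ n.

Lemma rep_start : rep start 0 (upd (fun=> 0) 0 n).
Proof.
exists (2 ^ n) => //; split=> [|r|k]; first by rewrite expn_gt0.
  rewrite lognX (@logn_prime _ (regp 0)) ?regp_prime // eq_regp /upd.
  by case: eqP => _; rewrite ?muln1 ?muln0.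
rewrite Euclid_dvdX ?labp_prime // n_gt0 andbT.
exact: negbT (labp_regp_dvd k 0).
Qed.

Lemma start_even : ~~ odd start.
Proof. by rewrite /start oddM oddX gtn_eqF // andbF. Qed.

Variable st : nat -> nat.
Hypothesis exec_p : exec p (upd (fun=> 0) 0 n) st.
Hypothesis st0 : st 0 = n.

(** A number on the orbit of [start] divisible by [labp e] has label [e], hence is a fixed point and
    equals the halting number [h]. Then [regp 1] divides it exactly when register 1 is nonzero. *)
Lemma halting_history :
  (exists ns, [/\ path (fun a b => b == fstep L a) start ns,
      labp e * regp 1 %| last start ns & ~~ odd (size (blocks ns))])
  <-> 0 < st 1.
Proof.
have lab0 : labels_lt 0 [::] by [].
have [k] := @fstep_rules p _ _ exec_p 0 e [::] [::] start lab0 rep_start.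
rewrite cats0 /= -/L; set h := iter k _ _ => reph.
have haltE m st' : rep m e st' -> fstep L m = m by exact: fstep_halt.
have hh := haltE _ _ reph.
have fixE m j : fstep L m = m -> iter j (fstep L) m = m.
  by move=> fm; elim: j => //= j ->.
split=> [[ns [pns Dns _]]|st1].
  have lastE : last start ns = iter (size ns) (fstep L) start.
    elim: ns start pns {Dns} => //= m ns IH a /andP[/eqP-> pns].
    by rewrite (IH _ pns) -iterSr.
  have [s' [st' rep']] := iter_fstep_rep p e (size ns) rep_start.
  rewrite -/L -lastE in rep'.
  have se : e = s'.
    by apply/eqP; rewrite -(rep_labp e rep') (dvdn_trans _ Dns) // dvdn_mulr.
  rewrite -se in rep'; have ll := haltE _ _ rep'.
  have lh : last start ns = h.
    rewrite -(fixE _ k ll) lastE -iterD addnC iterD -/h.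
    exact: fixE.
  by rewrite lh (rep_regp 1 reph) in Dns.
pose ns := traject (fstep L) (fstep L start) k.
have pns : path (fun a b => b == fstep L a) start ns.
  have := fpath_traject (fstep L) start k.
  by apply: sub_path => a b /=; rewrite eq_sym.
have lns : last start ns = h by rewrite last_traject.
have Dh : labp e * regp 1 %| h by rewrite (rep_regp 1 reph).
(* Register 0 still holds [n > 0], and its prime is 2. *)
have h_even : ~~ odd h.
  by rewrite -dvdn2 (regp_dvd_rep 0 reph) st0.
have [ons|ons] := boolP (odd (size (blocks ns))); last first.
  by exists ns; rewrite lns.
(* Repeating the fixed point [h] adds [h + 1] letters, an odd number, which repairs the parity. *)
exists (rcons ns h); rewrite rcons_path pns last_rcons lns hh eqxx; split=> //.
rewrite /blocks map_rcons flatten_rcons size_cat -/(blocks ns) size_rcons size_nseq.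
by rewrite oddD ons /= h_even.
Qed.

End Halting.

(** * Codes of the two automata *)

Lemma leq_size_code s : size s <= CodeSeq.code s.
Proof.
elim: s => //= n s IH; rewrite -[X in X <= _]mul1n leq_mul ?expn_gt0 //.
by rewrite ltnS; apply: leq_trans IH _; rewrite -addnn leq_addr.
Qed.

Lemma encode_seq_ord n (s : seq 'I_n) :
  encode_seq s = CodeSeq.code [seq val i | i <- s].
Proof. by rewrite /encode_seq; congr CodeSeq.code; apply: eq_map => i; exact: rank_ord. Qed.

Definition hist_code (X : nat) : nat :=
  CodeSeq.code [seq CodeSeq.code [:: t.1.1; t.1.2; 0; t.2; 0] | t <- hist_trans X].

Definition hist_pda_code (X : nat) : nat :=
  CodeSeq.code [:: 0; (X + 4).+1; CodeSeq.code [:: X + 4]; hist_code X; CodeSeq.code [:: 0]].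

Lemma encode_hist_pda X : encode_pda (hist_pda X) = hist_pda_code X.
Proof.
have transE : [seq encode_trans t | t <- trans (hist_pda X)] =
    [seq CodeSeq.code [:: t.1.1; t.1.2; 0; t.2; 0] | t <- hist_trans X].
  rewrite -map_comp; apply/eq_in_map => -[[q s] q'] /hist_trans_lt[qX sX q'X] /=.
  by rewrite !rank_ord !inordK.
rewrite /encode_pda transE !encode_seq_ord !card_ord !enum_set1.
by rewrite [map _ [:: inord (X + 4)]]/= [map _ [:: inord 0]]/= !val_inord.
Qed.

(** The code of the transitions does not depend on [N], which makes it possible to choose [N] from
    it. *)
Definition checker_code (P B : nat) (c d : nat -> nat) (acc : pred nat) : nat :=
  CodeSeq.code [seq CodeSeq.code
    (let y := key_next P B c d acc z in
     [:: num P B z.1.1; z.1.2; (z.2 : nat); num P B y.1; CodeSeq.code (nseq y.2 0)])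
    | z <- keys P B].

(** There are eight transitions per state, and a code is at least the length of its list; so this
    code is large enough to be the number of states. *)
Lemma checker_code_ge P B c d acc : size (states P B) < checker_code P B c d acc.
Proof.
apply: leq_trans (leq_size_code _).
by rewrite size_map /keys !size_allpairs /= -mulnA; have : 0 < size (states P B) by []; lia.
Qed.

(** [T] fills two fields: the number of states and the code of the transitions. *)
Definition checker_pda_code (T : nat) : nat :=
  CodeSeq.code [:: 1; T; CodeSeq.code [:: 2]; T; CodeSeq.code [:: 0; 1]].

Lemma enum_set01 N : 0 < N ->
  [seq val i | i <- enum [set inord 0; inord 1 : 'I_N.+1]] = [:: 0; 1].
Proof.
case: N => // N _.
have -> : [set inord 0; inord 1 : 'I_N.+2] = [set i | val i < 2].
  apply/setP => i; rewrite !inE -!val_eqE /= !inordK //.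
  by case: (val i) => [|[|]].
rewrite /enum_mem -enumT.
transitivity [seq m <- [seq val i | i <- enum 'I_N.+2] | m < 2].
  by rewrite filter_map; congr map; apply: eq_filter => i; rewrite /= inE.
rewrite val_enum_ord /=; do 2 congr (_ :: _); apply/eqP.
by rewrite -size_eq0 size_filter -leqn0 leqNgt -has_count -all_predC; apply/allP => i;
  rewrite mem_iota /=; lia.
Qed.

Lemma encode_key_trans P B c d acc N q x (top : bool) q' k :
  q <= N -> x < 4 -> q' <= N ->
  @encode_trans _ (checker_pda P B c d acc N)
    (inord q, inord x, if top then Some ord0 else None, inord q', nseq k ord0)
  = CodeSeq.code [:: q; x; top : nat; q'; CodeSeq.code (nseq k 0)].
Proof.
move=> qN x4 q'N; rewrite /encode_trans !rank_ord encode_seq_ord map_nseq.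
by rewrite (inordK (m := q)) // (inordK (m := x)) // (inordK (m := q')) //; case: top; rewrite ?rank_ord.
Qed.

Lemma encode_checker_pda P B c d acc : 0 < P ->
  encode_pda (checker_pda P B c d acc (checker_code P B c d acc).-1) =
  checker_pda_code (checker_code P B c d acc).
Proof.
move=> P_gt0; have T0 := checker_code_ge P B c d acc; set T := checker_code _ _ _ _ _ in T0 *.
have s3 : 2 < size (states P B) by [].
have transE : CodeSeq.code [seq encode_trans t
    | t <- trans (checker_pda P B c d acc T.-1)] = T.
  rewrite /T /checker_code -map_comp; congr CodeSeq.code.
  apply/eq_in_map => z zin.
  have [qs x4] : z.1.1 \in states P B /\ z.1.2 < 4.
    by move: zin; case: z => -[q x] top; rewrite mem_keys => /andP[].
  have num_le q : q \in states P B -> num P B q <= T.-1.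
    move=> qs'; rewrite -ltnS prednK; last exact: leq_ltn_trans T0.
    by apply: leq_trans (ltnW T0); rewrite index_mem.
  rewrite [LHS]encode_key_trans ?num_le //.
  case: z qs {zin x4} => -[q x] top qs; apply: mem_states; apply: pstep_ok => //.
  exact: phase_ok_states qs.
clearbody T; have T2 : 2 < T.-1.+1 by lia.
have init2 : [seq val i | i <- [:: inord 2 : 'I_T.-1.+1]] = [:: 2].
  by rewrite /= inordK.
rewrite /encode_pda transE !encode_seq_ord !card_ord enum_set01 ?enum_set1.
  by rewrite init2 prednK //; exact: leq_ltn_trans T0.
by rewrite -ltnS ltnW.
Qed.

(** * The instance as a computable function *)

Definition ted_code (n : nat) : nat :=
  CodeSeq.code [:: 4; hist_pda_code (start n); checker_pda_code n; 1].

(** [hist_trans] gains one transition at its head when [X] grows by one, so its code obeys a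
    primitive recursion with step [g]. *)
Lemma computable_hist_code : computable1 hist_code.
Proof.
pose g i h := cns (cns i.+4.+1 (cns 0 (cns 0 (cns i.+4 (cns 0 0))))) h.
apply: (@computable1_rec hist_code g) => //.
have ci : computable (fun x : 2.-tuple nat => tnth x ord0) by exact: computable_tnth.
have c0 : computable (fun _ : 2.-tuple nat => 0) by exact: computable_const.
apply: (computable_comp2 computable_cns); last exact: computable_tnth.
by do ![exact: c0 | exact: ci | apply: (computable_comp2 computable_cns)
      | apply: (computable_comp1 computable_S)].
Qed.

Lemma computable_start : computable1 start.
Proof.
apply: (@computable1_iter start double computable_double) => i.
by rewrite /start expnS mulnCA mul2n.
Qed.

Lemma computable_ted_code : computable1 ted_code.
Proof.
have cx : computable (fun x : 1.-tuple nat => thead x) by exact: computable_tnth.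
have cX := computable_comp1 computable_start cx.
have cH := computable_comp1 computable_hist_code cX.
have X4 : computable (fun x : 1.-tuple nat => start (thead x) + 4).
  have [f fP] : computable (fun x : 1.-tuple nat => (start (thead x)).+4).
    by do 4 apply: (computable_comp1 computable_S).
  by exists f => x; rewrite addn4.
pose F n := cns 4 (cns
  (cns 0 (cns (start n + 4).+1 (cns (cns (start n + 4) 0)
     (cns (hist_code (start n)) (cns (cns 0 0) 0)))))
  (cns (cns 1 (cns n (cns (cns 2 0) (cns n (cns (cns 0 (cns 1 0)) 0))))) (cns 1 0))).
(* [F] is [ted_code] with [CodeSeq.code] unfolded into [cns]. *)
suff: computable1 F by [].
by do ![exact: cx | exact: cH | exact: X4 | exact: computable_const
      | apply: (computable_comp2 computable_cns)
      | apply: (computable_comp1 computable_S)].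
Qed.

Lemma hist_pda_in_class C X : in_class C (hist_pda X).
Proof. by have [? ?] := hist_pda_dfa X; case: C. Qed.

Lemma encode_ted_hist C n (A2 : pda 'I_4) A1_in A2_in :
  encode_pda A2 = checker_pda_code n ->
  encode_ted (@TedInstance C DPDA 'I_4 (hist_pda (start n)) A2 1 A1_in A2_in)
  = ted_code n.
Proof. by move=> e; rewrite /encode_ted card_ord encode_hist_pda e. Qed.

Theorem proposition4 (R : realType) (C : automata_class) :
  undecidable (TED R C DPDA).
Proof.
case=> f fP; have [g gP] := computable_ted_code.
pose h : recfun 1 := RComp f (fun _ : 'I_1 => g).
(* Input in register 0, output in register 1. The input is preserved, as [halting_history]
   requires. *)
pose p := prog_of h [:: 0] 1 2; pose e := prog_size p; pose L := rules p 0 e.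
(* [D] divides a code exactly when the program has halted with a nonzero output. *)
pose D := labp e * regp 1.
have D0 : 0 < D by rewrite muln_gt0 labp_gt0 regp_gt0.
have L0 : all (fun ru => (0 < ru.1) && (0 < ru.2)) L by exact: rules_gt0.
pose P := fmod L D; pose B := fbound L D; pose c := fcoef L D; pose d := fstep L.
pose acc := [pred m | D %| m].
have P0 : 0 < P by exact: fmod_gt0.
(* The self-reference: [P], [B], [c], [d] and [acc] come from [f] alone, so the input [n] can be the
   code of the transitions that they define. *)
have [n nE] : exists n, n = checker_code P B c d acc by eexists.
have nS : size (states P B) < n by rewrite nE; exact: checker_code_ge.
have n0 : 0 < n by exact: leq_ltn_trans nS.
have A1_in : in_class C (hist_pda (start n)).
  exact: hist_pda_in_class.
have sN : size (states P B) <= n.-1.+1 by rewrite prednK // ltnW.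
have A2_in : in_class DPDA (checker_pda P B c d acc n.-1) by exact: checker_dpda.
pose I := @TedInstance C DPDA 'I_4 _ _ 1 A1_in A2_in.
have encI : encode_ted I = ted_code n.
  by apply: encode_ted_hist; rewrite nE; exact: encode_checker_pda.
have accE m : (m %% P \in acc) = (D %| m).
  by rewrite inE {2}(divn_eq m P) dvdn_addr // dvdn_mull // dvdn_mulr.
have yesE : @yes_instance (TED R C DPDA) I <-> ~ exists ns,
    [/\ path (fun a b => b == fstep L a) (start n) ns,
      D %| last (start n) ns & ~~ odd (size (blocks ns))].
  have colE : col P c d = fstep L by apply/funext => m; exact: col_fstep.
  have := @ted_histories (start n) P B n.-1 c d acc.
  rewrite colE => H; apply: (iff_trans (H _ P0 _ _ _ sN R)).
  - exact: start_even.
  - by move=> r; apply: fcoef_gt0.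
  - by move=> r /(@fbound_ge L D); rewrite -/B -/c; lia.
  - by move=> r /(@fbound_ge L D); rewrite -/B -/c -/d; lia.
  - by split=> nex [ns [pns Dns ons]]; apply: nex; exists ns; split=> //;
      move: Dns; rewrite -accE.
(* If [f] outputs [y] on the code of [I], the program halts on [n] with [y] in register 1. *)
have run y : computes f [tuple ted_code n] y ->
    (exists ns, [/\ path (fun a b => b == fstep L a) (start n) ns,
      D %| last (start n) ns & ~~ odd (size (blocks ns))]) <-> 0 < y.
  move=> fy; have hy : computes h [tuple n] y.
    exists [tuple ted_code n] => // i; rewrite (tnth_nth 0) (ord1 i).
    exact: gP [tuple n].
  have [|||||st [ex st1 str]] :=
    @exec_prog_of 1 h [:: 0] 1 2 (upd (fun=> 0) 0 n) [tuple n] y => //.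
  by rewrite -st1; apply: (halting_history n0 ex); rewrite str.
(* The answer 1 yields an accepting history, so [I] is a no-instance; the answer 0 excludes one, so
   [I] is a yes-instance. *)
have [/[dup] yes /(proj1 (fP I))|/[dup] no /(proj2 (fP I))] :=
  EM (@yes_instance (TED R C DPDA) I); rewrite /= encI => /run[hist1 hist2].
- exact: (proj1 yesE yes (hist2 erefl)).
- by apply: no; apply/yesE => /hist1.
Qed.
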